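(* Suppose $f(z,w)=(p(z),q(z,w))$ is an Axiom A polynomial skew product of $\mathbb{C}^2$ in the same hyperbolic component as a product $f_0(z,w)=(p_0(z),q_0(w))$. Then for all $z\in J_p$, the fiber Julia sets $J_z$ of $f$ are homeomorphic (to $J_{q_0}$, the Julia set of $q_0$).
   Context: A polynomial skew product of $\mathbb{C}^2$ is a map $f(z,w)=(p(z),q(z,w))$, with $p,q$ polynomials, that extends holomorphically to an endomorphism of $\mathbb{P}^2$ of degree $d\ge 2$ (so $p$ and $q$ both have degree $d$). Write $q_z(w)=q(z,w)$ and $Q_z^n=q_{p^{n-1}(z)}\circ\cdots\circ q_{p(z)}\circ q_z$. $K_p$ and $J_p=\partial K_p$ are the filled Julia set and Julia set of $p$; $A_p$ is the finite set of attracting periodic points of $p$ in $\mathbb{C}$. $K=\{x\in\mathbb{C}^2:\sup_n\|f^n(x)\|<\infty\}$, $K_z=K\cap(\{z\}\times\mathbb{C})$, and $J_z=\partial K_z$ (boundary in $\{z\}\times\mathbb{C}$). Vertical expansion: for a compact $Z\subseteq K_p$ with $p(Z)\subseteq Z$, $f$ is vertically expanding over $Z$ if there are $c>0$, $L>1$ with $|(Q_z^n)'(w)|\ge cL^n$ for all $z\in Z$, $w\in J_z$, $n\ge1$. Axiom A: (by a characterization of Jonsson, used as the definition) $f$ is Axiom A on $\mathbb{C}^2$ iff (i) $p$ is hyperbolic (expanding on $J_p$), (ii) $f$ is vertically expanding over $J_p$, and (iii) $f$ is vertically expanding over $A_p$. Hyperbolic component: the Axiom A maps form an open subset of the parameter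 space (space of coefficients) of all polynomial skew products of degree $d$; a hyperbolic component is a connected component of this open subset. *)

(* Defs.v *)
From HB Require Import structures.
From mathcomp Require Import all_boot all_order all_algebra.
From mathcomp Require Import complex.
From mathcomp Require Import all_classical all_reals all_analysis.

Set Implicit Arguments.
Unset Strict Implicit.
Unset Printing Implicit Defensive.

Import Order.TTheory GRing.Theory Num.Theory.
Import numFieldNormedType.Exports.

Local Open Scope classical_set_scope.
Local Open Scope ring_scope.
Local Open Scope complex_scope.

(* R[i], with its type declared as a numClosedFieldType so that the topology
   of the modulus (numFieldNormedType) is inferred.  The modulus `|z| has
   values in R[i] itself; real bounds are embedded by _%:C. *)
Definition Cx (R : realType) : numClosedFieldType := R[i].

Definition frontier (T : topologicalType) (A : set T) : set T :=
  closure A `\` interior A.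

Definition homeomorphic (T U : topologicalType) (A : set T) (B : set U) :=
  exists (phi : T -> U) (psi : U -> T),
    [/\ phi @` A `<=` B, psi @` B `<=` A,
        (forall x, A x -> psi (phi x) = x),
        (forall y, B y -> phi (psi y) = y) &
        {within A, continuous phi} /\ {within B, continuous psi}].

(* One-variable polynomial dynamics. *)

Definition poly_iter (R : realType) (p : {poly Cx R}) (n : nat) :
  {poly Cx R} := iter n (fun r => p \Po r) 'X.

Definition filled_julia (R : realType) (p : {poly Cx R}) : set (Cx R) :=
  [set z | exists M : R, forall n, `|iter n (horner p) z| <= M%:C].

Definition julia (R : realType) (p : {poly Cx R}) : set (Cx R) :=
  frontier (filled_julia p).

Definition attracting_periodic (R : realType) (p : {poly Cx R}) :
    set (Cx R) :=
  [set z | exists n : nat, [/\ (0 < n)%N, iter n (horner p) z = z &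
                               `|(poly_iter p n)^`().[z]| < 1]].

Definition hyperbolic_poly (R : realType) (p : {poly Cx R}) : Prop :=
  exists c L : R, [/\ 0 < c, 1 < L &
    forall z n, julia p z -> (1 <= n)%N ->
      (c * L ^+ n)%:C <= `|(poly_iter p n)^`().[z]|].

(* Coefficients of a pair (p, q) of degree at most d: the first component lists
   the coefficients of p, and entry (i, j) of the second one is the coefficient
   of z^i w^j in q.  The parameter space has the product topology. *)
Notation coeffs R d := ('rV[Cx R]_d.+1 * 'M[Cx R]_d.+1)%type.

Definition base_poly (R : realType) (d : nat) (f : coeffs R d) :
  {poly Cx R} := rVpoly f.1.

Definition fiber_poly (R : realType) (d : nat) (f : coeffs R d) (z : Cx R) :
    {poly Cx R} :=
  \sum_(i < d.+1) \sum_(j < d.+1) (f.2 i j * z ^+ i) *: 'X^j.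

Definition skew_map (R : realType) (d : nat) (f : coeffs R d)
    (x : Cx R * Cx R) : Cx R * Cx R :=
  ((base_poly f).[x.1], (fiber_poly f x.1).[x.2]).

(* The degree-d homogenization
   (z, w, t) |-> (t^d p(z/t), t^d q(z/t, w/t), t^d) on C^3.  The monomials with
   i + j > d are excluded in is_skew_product, so dropping them is harmless. *)
Definition homogenization (R : realType) (d : nat) (f : coeffs R d)
    (z w t : Cx R) : Cx R * Cx R * Cx R :=
  (\sum_(i < d.+1) f.1 ord0 i * z ^+ i * t ^+ (d - i),
   \sum_(i < d.+1) \sum_(j < d.+1 | (i + j <= d)%N)
      f.2 i j * z ^+ i * w ^+ j * t ^+ (d - (i + j)),
   t ^+ d).

(* q has total degree at most d, and the homogenization has no zero but the
   origin, i.e. it induces an endomorphism of P^2 of degree d. *)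
Definition is_skew_product (R : realType) (d : nat) (f : coeffs R d) : Prop :=
  (forall i j : 'I_d.+1, (d < i + j)%N -> f.2 i j = 0) /\
  (forall z w t : Cx R, homogenization f z w t = (0, 0, 0) ->
     [/\ z = 0, w = 0 & t = 0]).

(* Q_z^n = q_{p^{n-1}(z)} o ... o q_{p(z)} o q_z *)
Fixpoint fiber_iter (R : realType) (d : nat) (f : coeffs R d) (n : nat)
    (z : Cx R) : {poly Cx R} :=
  if n is m.+1 then
    fiber_iter f m (base_poly f).[z] \Po fiber_poly f z
  else 'X.

Definition skew_filled_julia (R : realType) (d : nat) (f : coeffs R d) :
    set (Cx R * Cx R) :=
  [set x | exists M : R, forall n, `|iter n (skew_map f) x| <= M%:C].

Definition fiber_filled_julia (R : realType) (d : nat) (f : coeffs R d)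
    (z : Cx R) : set (Cx R) :=
  [set w | skew_filled_julia f (z, w)].

Definition fiber_julia (R : realType) (d : nat) (f : coeffs R d) (z : Cx R) :
    set (Cx R) :=
  frontier (fiber_filled_julia f z).

(* Used below only for Z the Julia set or the set of attracting periodic points
   of the base polynomial: both are compact, forward invariant and contained in
   the filled Julia set. *)
Definition vertically_expanding (R : realType) (d : nat) (f : coeffs R d)
    (Z : set (Cx R)) : Prop :=
  exists c L : R, [/\ 0 < c, 1 < L &
    forall z w n, Z z -> fiber_julia f z w -> (1 <= n)%N ->
      (c * L ^+ n)%:C <= `|(fiber_iter f n z)^`().[w]|].

Definition axiomA (R : realType) (d : nat) (f : coeffs R d) : Prop :=
  [/\ hyperbolic_poly (base_poly f),
      vertically_expanding f (julia (base_poly f)) &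
      vertically_expanding f (attracting_periodic (base_poly f))].

Definition axiomA_locus (R : realType) (d : nat) : set (coeffs R d) :=
  [set f | is_skew_product f /\ axiomA f].

Definition hyperbolic_component (R : realType) (d : nat)
    (H : set (coeffs R d)) : Prop :=
  exists2 f, @axiomA_locus R d f & H = connected_component (@axiomA_locus R d) f.

(* Main.v *)
(** Call a parameter good if every fiber Julia set over its base Julia set is
    homeomorphic to J_{q0}.  A hyperbolic component is connected, so it suffices
    that goodness is locally constant on the hyperbolic locus.

    A perturbation h of a map g of that locus is compared with g fiberwise, first
    for the base polynomial (one fiber), then for the maps Q_z^N over J_p.  Both
    are families F_x of polynomials over a map x |-> sg x, expanding on the
    boundaries J_x of the sets of bounded orbits.  Pulling back along roots close
    to an F-orbit in J produces a unique shadowing orbit of the perturbed family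
    G, and expansion along it forces the shadow to lie in the boundary for G (a
    disc of bounded orbits would bound the derivatives, by Cauchy's estimates).
    For the converse one needs that the boundary for G is close to that of F.
    This replaces the stability of the Fatou set: points of a disc far from J
    keep G-orbits far from J, so the iterates of G omit discs of a fixed radius
    there, hence (Schwarz lemma for 1 / (G^n - a_n)) are uniformly bounded near
    any point with bounded orbit, which is thus interior. *)
Require Import Defs.
From mathcomp Require Import all_boot all_order all_algebra all_solvable all_field.
From mathcomp Require Import complex.
From mathcomp Require Import all_classical all_reals all_analysis.
From mathcomp Require Import ring lra zify.
Import Order.TTheory GRing.Theory Num.Theory.
Import numFieldNormedType.Exports.
Local Open Scope classical_set_scope.
Local Open Scope ring_scope.

Set Implicit Arguments.
Unset Strict Implicit.
Unset Printing Implicit Defensive.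

(** * The modulus of a complex number *)

Section Modulus.
Context {R : realType}.
Implicit Types z w : Cx R.

(** The modulus as an element of [R]: the norm of [Cx R] lies in [R[i]], which is only partially
    ordered. *)
Definition cmod z : R := Normc.normc z.

Lemma normE z : `|z| = (cmod z)%:C%C.
Proof. by case: z. Qed.

Lemma le_cmod z (r : R) : (`|z| <= r%:C%C) = (cmod z <= r).
Proof. by rewrite normE lecR. Qed.

Lemma ge_cmod z (r : R) : (r%:C%C <= `|z|) = (r <= cmod z).
Proof. by rewrite normE lecR. Qed.

Lemma cmod_ge0 z : 0 <= cmod z.
Proof. by rewrite -ge_cmod normr_ge0. Qed.

Lemma cmodM z w : cmod (z * w) = cmod z * cmod w.
Proof. exact: Normc.normcM. Qed.

Lemma cmod1 : cmod 1 = 1.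
Proof. exact: Normc.normc1. Qed.

Lemma cmod0 : cmod 0 = 0.
Proof. exact: Normc.normc0. Qed.

Lemma cmod_eq0 z : (cmod z == 0) = (z == 0).
Proof. by apply/eqP/eqP => [/Normc.eq0_normc|->//]; rewrite ?cmod0. Qed.

Lemma cmod_gt0 z : (0 < cmod z) = (z != 0).
Proof. by rewrite lt_def cmod_ge0 andbT cmod_eq0. Qed.

Lemma cmodD z w : cmod (z + w) <= cmod z + cmod w.
Proof. exact: le_normcD. Qed.

Lemma cmodN z : cmod (- z) = cmod z.
Proof. exact: normcN. Qed.

Lemma cmodC z w : cmod (z - w) = cmod (w - z).
Proof. by rewrite -cmodN opprB. Qed.

Lemma cmod_triangle u z w : cmod (z - w) <= cmod (z - u) + cmod (u - w).
Proof. by rewrite -[z - w](subrKA u) cmodD. Qed.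

Lemma cmodB_ge z w : cmod z - cmod w <= cmod (z - w).
Proof. by rewrite lerBlDr -{1}[z](subrK w) cmodD. Qed.

Lemma cmodV z : cmod z^-1 = (cmod z)^-1.
Proof. exact: Normc.normcV. Qed.

Lemma cmodX z n : cmod (z ^+ n) = cmod z ^+ n.
Proof. by elim: n => [|n IH]; rewrite ?cmod1 // !exprS cmodM IH. Qed.

Lemma cmod_sum (I : Type) (r : seq I) (P : pred I) (F : I -> Cx R) :
  cmod (\sum_(i <- r | P i) F i) <= \sum_(i <- r | P i) cmod (F i).
Proof.
elim/big_ind2: _ => [|x1 x2 y1 y2 h1 h2|//]; first by rewrite cmod0.
by rewrite (le_trans (cmodD _ _)) // lerD.
Qed.

Lemma cmod_prod (I : Type) (r : seq I) (P : pred I) (F : I -> Cx R) :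
  cmod (\prod_(i <- r | P i) F i) = \prod_(i <- r | P i) cmod (F i).
Proof. by apply: (big_morph cmod) => [x y|]; rewrite ?cmodM ?cmod1. Qed.

Lemma cmod_real (r : R) : cmod r%:C%C = `|r|.
Proof. by rewrite /cmod /= expr0n /= addr0 sqrtr_sqr. Qed.

Lemma cmod_nat n : cmod (n%:R) = n%:R.
Proof. by rewrite -(rmorph_nat (real_complex R)) cmod_real normr_nat. Qed.

Lemma cmod_Re z : `|complex.Re z| <= cmod z.
Proof.
case: z => a b; rewrite /cmod /= -sqrtr_sqr.
by rewrite ler_wsqrtr // lerDl sqr_ge0.
Qed.

Lemma cmod_Im z : `|complex.Im z| <= cmod z.
Proof.
case: z => a b; rewrite /cmod /= -sqrtr_sqr.
by rewrite ler_wsqrtr // lerDr sqr_ge0.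
Qed.

Lemma cmod_le_ReIm z : cmod z <= `|complex.Re z| + `|complex.Im z|.
Proof.
rewrite {1}(complexE z) (le_trans (cmodD _ _)) // cmodM !cmod_real.
suff -> : cmod 'i%C = 1 by rewrite mul1r.
by rewrite /cmod /= expr0n /= add0r expr1n sqrtr1.
Qed.

Lemma ball_cmod z w (e : R) : ball z e%:C%C w <-> cmod (z - w) < e.
Proof. by rewrite -ball_normE /ball_ /= normE ltcR. Qed.

Lemma nbhs_cmodP z (A : set (Cx R)) :
  nbhs z A <-> exists2 e, 0 < e & forall w, cmod (w - z) < e -> A w.
Proof.
split=> [/nbhs_ballP[e /= e0 sA]|[e e0 sA]].
  have eR : e = (complex.Re e)%:C%C by rewrite RRe_real ?gtr0_real.
  exists (complex.Re e) => [|w hw]; first by rewrite -ltcR -eR.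
  by apply: sA; rewrite eR ball_cmod cmodC.
apply/nbhs_ballP; exists e%:C%C; first by rewrite /= ltcR.
by move=> w /ball_cmod hw; apply: sA; rewrite cmodC.
Qed.

(** Bolzano-Weierstrass, from the compactness of a square containing all pairs of real and imaginary
    parts. *)
Lemma cluster_point (u : nat -> Cx R) (M : R) : (forall n, cmod (u n) <= M) ->
  exists a, forall e, 0 < e -> forall n, exists2 k, (n <= k)%N & cmod (u k - a) < e.
Proof.
move=> hM.
pose v n : R * R := (complex.Re (u n), complex.Im (u n)).
have cpt : compact (`[- M, M] `*` `[- M, M]) by apply: compact_setX; apply: segment_compact.
have [|[a b] [_ hab]] := cpt (v @ \oo) _.
  exists 0%N => // n _; rewrite /= !in_itv /= -!ler_norml.
  by rewrite !(le_trans _ (hM n)) ?cmod_Re ?cmod_Im.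
exists (Complex a b) => e e0 n.
have e20 : 0 < e / 2 by rewrite divr_gt0.
have [||[_ _] [[k /= nk [<- <-]] [/=]]] :=
   hab [set v k | k in [set k | (n <= k)%N]] (ball a (e / 2) `*` ball b (e / 2)).
- by exists n => // k /= nk; exists k.
- by exists (ball a (e/2), ball b (e/2)); first by split; apply: nbhsx_ballx.
rewrite -!ball_normE /ball_ /= => h1 h2; exists k => //.
apply: le_lt_trans (cmod_le_ReIm _) _.
rewrite distrC in h1; rewrite distrC in h2.
case: (u k) h1 h2 => c d /= h1 h2.
by rewrite [e]splitr ltrD.
Qed.

End Modulus.
Arguments cmod : simpl never.

(** * Estimates for complex polynomials *)

Section PolynomialEstimates.
Context {R : realType}.
Implicit Types (T p : {poly Cx R}) (u v w y z : Cx R).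

(** In characteristic 0 the split polynomial X^n - 1 is separable, and among n distinct n-th roots
    of unity one is primitive. *)
Lemma primitive_root_exists n : (0 < n)%N ->
  exists z : Cx R, n.-primitive_root z.
Proof.
move=> n0; have [r Dp] := closed_field_poly_normal ('X^n - 1 : {poly Cx R}).
rewrite (monicP _) ?monicXnsubC // scale1r in Dp.
have rn1 : all n.-unity_root r by apply/allP=> z; rewrite -root_prod_XsubC -Dp.
have sz_r : (n < (size r).+1)%N.
  by rewrite -(size_prod_XsubC r id) -Dp size_XnsubC.
have [|z] := hasP (has_prim_root n0 rn1 _ sz_r); last by exists z.
by rewrite -separable_prod_XsubC -Dp separable_Xn_sub_1 // pnatr_eq0 -lt0n.
Qed.

(* Averaging [T (rho * omega ^ j) * omega ^ (- j k)] over the powers of a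
   primitive root of unity [omega] of large order isolates the coefficient. *)
Lemma cauchy_coef T (A rho : R) k : 0 < rho ->
  (forall z, cmod z <= rho -> cmod T.[z] <= A) -> cmod T`_k * rho ^+ k <= A.
Proof.
(* Every exponent occurring in [T], and [k] itself, is below [N], so distinct exponents stay
   distinct modulo [N]. *)
move=> rho0 hT; set N := (size T + k).+1.
have [om om_prim] := @primitive_root_exists N isT.
have om1 : cmod om = 1.
  have /eqP : cmod om ^+ N = 1 by rewrite -cmodX (prim_expr_order om_prim) cmod1.
  by rewrite pexpr_eq1 ?cmod_ge0 // => /eqP.
have om0 : om != 0 by rewrite -cmod_gt0 om1.
have kN : (k < N)%N by rewrite ltnS leq_addl.
have szT : (size T <= N)%N by rewrite leqW // leq_addr.
set c : Cx R := rho%:C%C.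
have expE (j l : nat) : T`_l * (c * om ^+ j) ^+ l * (om ^- k) ^+ j
    = T`_l * c ^+ l * (om ^+ l * om ^- k) ^+ j.
  move: (om ^- k) => q; move: c => c'.
  by rewrite [(c' * _) ^+ l]exprMn [(_ * q) ^+ j]exprMn exprAC !mulrA.
have key : \sum_(j < N) T.[c * om ^+ j] * (om ^- k) ^+ j
         = N%:R * (T`_k * c ^+ k).
  have -> : \sum_(j < N) T.[c * om ^+ j] * (om ^- k) ^+ j
    = \sum_(j < N) \sum_(l < N) T`_l * c ^+ l * (om ^+ l * om ^- k) ^+ j.
    apply: eq_bigr => j _.
    rewrite (horner_coef_wide _ szT) mulr_suml.
    by apply: eq_bigr => l _; exact: expE.
  rewrite exchange_big /= (bigD1 (Ordinal kN)) //= [X in _ + X]big1 => [|l lk].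
    rewrite addr0.
    have xk : om ^+ k * om ^- k = 1 by rewrite mulfV // expf_neq0.
    transitivity (\sum_(j < N) T`_k * c ^+ k).
      by apply: eq_bigr => j _; rewrite xk expr1n mulr1.
    by rewrite sumr_const card_ord mulr_natl.
  (* [x] is an [N]-th root of unity other than 1, so its geometric sum vanishes. *)
  rewrite -mulr_sumr; set x := om ^+ l * _.
  have x1 : x - 1 != 0.
    rewrite subr_eq0; apply: contra lk => /eqP xE.
    have /eqP : om ^+ l = om ^+ k.
      by rewrite -[LHS](mulfVK (expf_neq0 k om0)) -/x xE mul1r.
    by rewrite (eq_prim_root_expr om_prim) !modn_small.
  have : x ^+ N - 1 = 0.
    rewrite exprMn exprVn -!exprM [(l * _)%N]mulnC [(k * _)%N]mulnC !exprM.
    by rewrite (prim_expr_order om_prim) !expr1n mul1r invr1 subrr.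
  rewrite subrX1 => /eqP; rewrite mulf_eq0 (negbTE x1) /= => /eqP ->.
  by rewrite mulr0.
have N0 : 0 < N%:R :> R by rewrite ltr0n.
rewrite -(ler_pM2l N0).
have -> : N%:R * (cmod T`_k * rho ^+ k)
        = cmod (N%:R * (T`_k * c ^+ k)) :> R.
  by rewrite !cmodM cmodX cmod_nat cmod_real gtr0_norm.
rewrite -key (le_trans (cmod_sum _ _ _)) //.
apply: (@le_trans _ _ (\sum_(j < N) A)); last first.
  by rewrite sumr_const card_ord mulr_natl.
apply: ler_sum => j _; rewrite cmodM cmodX cmodV cmodX om1 expr1n invr1 expr1n.
rewrite mulr1 hT // cmodM cmodX om1 expr1n mulr1 cmod_real gtr0_norm //.
Qed.

(** The factor k + 1 of the telescoped difference is weakened to 2^k, so that the Taylor tail in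
    [taylor_bound] becomes geometric. *)
Lemma cmod_subX (s : R) u v k : cmod u <= s -> cmod v <= s ->
  cmod (u ^+ k.+1 - v ^+ k.+1) <= (2 * s) ^+ k * cmod (u - v).
Proof.
move=> us vs; rewrite subrXX cmodM mulrC ler_wpM2r ?cmod_ge0 //.
apply: le_trans (cmod_sum _ _ _) _.
have s0 : 0 <= s by rewrite (le_trans (cmod_ge0 _) us).
apply: (@le_trans _ _ (\sum_(i < k.+1) s ^+ k)).
  apply: ler_sum => i _; rewrite cmodM !cmodX.
  have -> : s ^+ k = s ^+ (k - i) * s ^+ i.
    by rewrite -exprD subnK // -ltnS.
  by rewrite ler_pM ?exprn_ge0 ?cmod_ge0 // lerXn2r ?nnegrE ?cmod_ge0.
rewrite sumr_const card_ord exprMn -[leLHS]mulr_natl ler_wpM2r ?exprn_ge0 //.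
by rewrite -natrX ler_nat ltn_expl.
Qed.

Lemma sum_geometric_le (q : R) n : 0 <= q <= 1 / 2 ->
  \sum_(i < n) q ^+ i <= 2.
Proof.
move=> /andP[q0 q2]; elim: n => [|n IH]; first by rewrite big_ord0.
rewrite big_ord_recl expr0.
under eq_bigr => i _ do rewrite /bump /= exprS.
rewrite -mulr_sumr.
have : 0 <= \sum_(i < n) q ^+ i by apply: sumr_ge0 => i _; exact: exprn_ge0.
nra.
Qed.

Lemma horner_shift T w z : (T \Po ('X + w%:P)).[z] = T.[z + w].
Proof. by rewrite horner_comp !hornerE. Qed.

(** By Cauchy's estimates the k-th coefficient of T(X + w) is at most A / rho^k, and the terms of
    order at least 2 are dominated by a geometric series of ratio 2 s / rho, at most 1/2. *)
Lemma taylor_bound T w (A rho s : R) u v : 0 < rho ->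
  (forall z, cmod (z - w) <= rho -> cmod T.[z] <= A) -> 4 * s <= rho ->
  cmod (u - w) <= s -> cmod (v - w) <= s ->
  cmod T^`().[w] <= A / rho /\
  cmod (T.[u] - T.[v] - T^`().[w] * (u - v))
    <= 4 * A * s / rho ^+ 2 * cmod (u - v).
Proof.
move=> rho0 hT srho us vs; set S := T \Po ('X + w%:P).
have hS z : cmod z <= rho -> cmod S.[z] <= A.
  by move=> hz; rewrite horner_shift hT // addrK.
have Sc k : cmod S`_k <= A / rho ^+ k.
  by rewrite ler_pdivlMr ?exprn_gt0 // cauchy_coef.
have S1 : S`_1 = T^`().[w].
  have -> : S`_1 = S^`().[0] by rewrite horner_coef0 coef_deriv mulr1n.
  by rewrite deriv_comp derivD derivX derivC addr0 mulr1 horner_shift add0r.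
split; first by rewrite -S1 -[rho]expr1 Sc.
have -> : u - v = (u - w) - (v - w) by rewrite opprB addrA subrK.
have -> : T.[u] = S.[u - w] by rewrite horner_shift subrK.
have -> : T.[v] = S.[v - w] by rewrite horner_shift subrK.
rewrite -S1; move: (u - w) (v - w) us vs => {}u {}v us vs.
have s0 : 0 <= s by rewrite (le_trans (cmod_ge0 _) us).
have A0 : 0 <= A by rewrite (le_trans (cmod_ge0 _) (hS 0 _)) ?cmod0 ?ltW.
(* Two spare coefficients allow the terms of order 0 and 1 to be split off whatever the size of
   [S]. *)
have szS : (size S <= (size S).+2)%N by rewrite ltnW.
rewrite !(horner_coef_wide _ szS) !big_ord_recl !lift0 !expr0 !expr1 !mulr1.
set U := \sum_(i < _) _; set V := \sum_(i < _) _.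
have -> : S`_0 + (S`_1 * u + U) - (S`_0 + (S`_1 * v + V)) - S`_1 * (u - v)
        = U - V by ring.
rewrite /U /V -sumrB.
apply: le_trans (cmod_sum _ _ _) _.
set q := 2 * s / rho.
apply: (@le_trans _ _
  (\sum_(i < size S) (A / rho * q * cmod (u - v)) * q ^+ i)).
  apply: ler_sum => i _; rewrite -mulrBr cmodM !lift0.
  apply: (@le_trans _ _ (A / rho ^+ i.+2 * ((2 * s) ^+ i.+1 * cmod (u - v)))).
    by rewrite ler_pM ?cmod_ge0 // cmod_subX.
  rewrite le_eqVlt; apply/orP; left; apply/eqP.
  rewrite /q !exprMn exprVn !exprS; field.
  by rewrite expf_neq0 ?lt0r_neq0.
have qb : 0 <= q <= 1 / 2.
  apply/andP; split; first by apply: divr_ge0; [exact: mulr_ge0|exact: ltW].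
  by rewrite ler_pdivrMr //; lra.
rewrite -mulr_sumr.
have := @sum_geometric_le q (size S) qb; set Q := \sum_(i < _) _ => hQ.
have c0 : 0 <= A / rho * q * cmod (u - v).
  by rewrite !mulr_ge0 ?cmod_ge0 ?invr_ge0 ?(ltW rho0).
apply: le_trans (ler_wpM2l c0 hQ) _.
rewrite le_eqVlt; apply/orP; left; apply/eqP; rewrite /q; field.
by rewrite lt0r_neq0.
Qed.

Lemma lipschitz_of_bound T w (A rho : R) u v : 0 < rho ->
  (forall z, cmod (z - w) <= rho -> cmod T.[z] <= A) ->
  4 * cmod (u - w) <= rho -> 4 * cmod (v - w) <= rho ->
  cmod (T.[u] - T.[v]) <= 2 * A / rho * cmod (u - v).
Proof.
move=> rho0 hT us vs.
have [|||h1 h2] := @taylor_bound T w A rho (rho / 4) u v rho0 hT.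
- lra.
- by rewrite ler_pdivlMr // mulrC.
- by rewrite ler_pdivlMr // mulrC.
have -> : T.[u] - T.[v]
  = (T.[u] - T.[v] - T^`().[w] * (u - v)) + T^`().[w] * (u - v) by ring.
rewrite (le_trans (cmodD _ _)) // cmodM.
have -> : 2 * A / rho * cmod (u - v)
   = 4 * A * (rho / 4) / rho ^+ 2 * cmod (u - v) + A / rho * cmod (u - v).
  by field; rewrite lt0r_neq0.
by rewrite lerD // ler_wpM2r ?cmod_ge0.
Qed.

Lemma poly_root_factor p : p != 0 ->
  exists rs : seq (Cx R), [/\ size p = (size rs).+1,
    forall z, p.[z] = lead_coef p * \prod_(r <- rs) (z - r) &
    forall r, r \in rs -> p.[r] = 0].
Proof.
move=> p0; have [rs Dp] := closed_field_poly_normal p.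
exists rs; split.
- by rewrite Dp size_scale ?lead_coef_eq0 // size_prod_XsubC.
- move=> z; rewrite {1}Dp hornerZ horner_prod.
  by under eq_bigr => r _ do rewrite hornerXsubC.
- move=> r rrs; apply/eqP; rewrite -[_ == _]/(root p r) Dp rootZ.
    by rewrite root_prod_XsubC.
  by rewrite lead_coef_eq0.
Qed.

(** If all d roots of p - y were farther than e from w, the factorization would give |p(w) - y| > m
    e^d. The modulus depends on p only through m and d, hence is common to all nearby
    polynomials. *)
Lemma root_nearby d p w y (m e : R) : (0 < d)%N -> (size p <= d.+1)%N ->
  0 < m -> m <= cmod p`_d -> 0 <= e -> cmod (p.[w] - y) <= m * e ^+ d ->
  exists2 b, p.[b] = y & cmod (w - b) <= e.
Proof.
move=> d0 szp m0 hm e0 hw; set q := p - y%:P.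
have qd : q`_d = p`_d by rewrite coefB coefC gtn_eqF // subr0.
have qd0 : q`_d != 0 by rewrite qd -cmod_gt0 (lt_le_trans m0).
have szq : size q = d.+1.
  apply/eqP; rewrite eqn_leq; apply/andP; split; last first.
    by rewrite ltnNge; apply: contra qd0 => /leq_sizeP ->.
  rewrite (leq_trans (size_polyD _ _)) // geq_max szp size_polyN.
  by rewrite (leq_trans (size_polyC_leq1 _)).
have q0 : q != 0 by rewrite -size_poly_gt0 szq.
have [rs [szrs Dq rts]] := poly_root_factor q0.
have szd : size rs = d by apply/eqP; rewrite -eqSS -szrs szq.
have lq : lead_coef q = p`_d by rewrite lead_coefE szq.
have [/hasP[b brs hb]|/hasPn far] := boolP (has (fun b => cmod (w - b) <= e) rs).
  exists b => //; apply/eqP; rewrite -subr_eq0.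
  by have := rts b brs; rewrite !hornerE => ->.
exfalso; move: hw; have -> : p.[w] - y = q.[w] by rewrite !hornerE.
rewrite Dq lq cmodM cmod_prod leNgt => /negP; apply.
have P0 : e ^+ d < \prod_(r <- rs) cmod (w - r).
  rewrite -szd; have : (0 < size rs)%N by rewrite szd.
  elim: rs far {szrs Dq rts szd} => // r rs IH far _.
  have hr : e < cmod (w - r) by rewrite ltNge far // mem_head.
  rewrite big_cons exprS; case: rs IH far => [|r' rs] IH far.
    by rewrite big_nil expr0 !mulr1.
  by rewrite ltr_pM ?exprn_ge0 // IH // => x xrs; rewrite far // in_cons xrs orbT.
apply: (@lt_le_trans _ _ (m * \prod_(r <- rs) cmod (w - r))).
  by rewrite ltr_pM2l.
by rewrite ler_wpM2r // (le_trans _ (ltW P0)) // exprn_ge0.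
Qed.

Lemma poly_bounded p (rho : R) : exists2 A, 0 <= A &
  forall z, cmod z <= rho -> cmod p.[z] <= A.
Proof.
exists (\sum_(i < size p) cmod p`_i * `|rho| ^+ i).
  by apply: sumr_ge0 => i _; rewrite mulr_ge0 ?cmod_ge0 // exprn_ge0.
move=> z hz; rewrite horner_coef (le_trans (cmod_sum _ _ _)) //.
apply: ler_sum => i _; rewrite cmodM cmodX ler_wpM2l ?cmod_ge0 //.
by rewrite lerXn2r ?nnegrE ?cmod_ge0 // (le_trans hz) // ler_norm.
Qed.

Lemma poly_cont p w (e : R) : 0 < e -> exists2 del, 0 < del &
  forall u, cmod (u - w) < del -> cmod (p.[u] - p.[w]) < e.
Proof.
move=> e0; have [A A0 hA] := poly_bounded p (cmod w + 1).
have A1 : 0 < 2 * A + 1 by lra.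
exists (Num.min (1 / 4) (e / (2 * A + 1))).
  by rewrite lt_min divr_gt0 //= divr_gt0.
move=> u; rewrite lt_min => /andP[u1 u2].
apply: le_lt_trans (@lipschitz_of_bound p w A 1 u w ltr01 _ _ _) _.
- move=> z hz; apply: hA; rewrite -[z](subrK w) (le_trans (cmodD _ _)) //.
  by rewrite addrC lerD2l.
- by rewrite mulrC -ler_pdivlMr // ltW.
- by rewrite subrr cmod0 mulr0.
rewrite divr1; move: u2; rewrite ltr_pdivlMr // => u2.
have := cmod_ge0 (u - w); nra.
Qed.

End PolynomialEstimates.

(** * Polynomials that omit a disc around 0 *)

Section Reciprocal.
Context {R : realType}.
Implicit Types (T p : {poly Cx R}) (u v w y z : Cx R).

Lemma prod_one_sub_bounds (rs : seq (Cx R)) (t : R) :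
  0 <= t -> (size rs)%:R * t <= 1 / 2 -> (forall r, r \in rs -> cmod r <= t) ->
  1 / 2 <= cmod (\prod_(r <- rs) (1 - r)) <= 2.
Proof.
move=> t0 ht hr.
(* The upper bound is put in the multiplied form P (1 - n t) <= 1, which passes through the
   induction because (1 + t) (1 - t) <= 1. *)
suff [h1 h2] : 1 - (size rs)%:R * t <= cmod (\prod_(r <- rs) (1 - r)) /\
   cmod (\prod_(r <- rs) (1 - r)) * (1 - (size rs)%:R * t) <= 1.
  apply/andP; split; first lra.
  have := cmod_ge0 (\prod_(r <- rs) (1 - r)); nra.
elim: rs ht hr => [|r rs IH] ht hr.
  by rewrite big_nil cmod1 mul0r subr0 mulr1.
have rt : cmod r <= t by rewrite hr // mem_head.
have n0 : 0 <= (size rs)%:R :> R by [].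
have [||h1 h2] := IH.
- by move: ht; rewrite /= -natr1; nra.
- by move=> x xrs; rewrite hr // in_cons xrs orbT.
move: ht; rewrite big_cons cmodM /= -natr1 => ht.
have l1 : 1 - t <= cmod (1 - r).
  by rewrite (le_trans _ (cmodB_ge _ _)) // cmod1 lerD2l lerN2.
have l2 : cmod (1 - r) <= 1 + t.
  by rewrite (le_trans (cmodD _ _)) // cmod1 cmodN lerD2l.
move: h1 h2 l1 l2 n0 ht; set P := cmod (\prod_(_ <- _) _).
have : 0 <= P by exact: cmod_ge0.
have : 0 <= cmod (1 - r) by exact: cmod_ge0.
move: (cmod _) P (_%:R) => a P n a0 P0 h1 h2 l1 l2 n0 ht.
have nt0 : 0 <= n * t by rewrite mulr_ge0.
have nt3 : 0 <= n * t * t by rewrite mulr_ge0.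
have nt2 : 1 - (n + 1) * t <= (1 - t) * (1 - n * t) by lra.
split.
  apply: (@le_trans _ _ ((1 - t) * (1 - n * t))) => //.
  by rewrite ler_pM //; lra.
apply: (@le_trans _ _ ((a * P) * ((1 - t) * (1 - n * t)))).
  by rewrite ler_wpM2l // mulr_ge0.
have -> : a * P * ((1 - t) * (1 - n * t)) = (a * (1 - t)) * (P * (1 - n * t)).
  by ring.
have x1 : a * (1 - t) <= 1.
  apply: (@le_trans _ _ ((1 + t) * (1 - t))); last by nra.
  by rewrite ler_wpM2r //; lra.
apply: le_trans (ler_piMl _ x1) h2.
by rewrite mulr_ge0 //; lra.
Qed.

(* With [rho_i] the roots of [p (w + X)], all of modulus at least [r], the
   polynomial [T = \prod_i \sum_(k < N) ('X / rho_i) ^ k] satisfies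
   [p (w + z) T z = p w \prod_i (1 - (z / rho_i) ^ N)]: for [N] large it is a
   polynomial substitute for [p w / p (w + X)], to which the Lipschitz bound
   applies. *)
Lemma bounded_of_omitted_disc (eta M r : R) : 0 < eta -> 0 < M -> 0 < r ->
  exists2 r', 0 < r' & forall p w,
   (forall z, cmod (z - w) <= r -> eta <= cmod p.[z]) -> cmod p.[w] <= M ->
   forall u, cmod (u - w) <= r' -> cmod p.[u] <= 4 * M.
Proof.
move=> eta0 M0 r0; set A := 2 * M / eta.
have A0 : 0 < A by rewrite divr_gt0 // mulr_gt0.
(* r / 8 is the range of [lipschitz_of_bound] on a disc of radius r / 2; r / (8 A) makes its
   constant 4 A / r times |u - w| at most 1/2. *)
exists (Num.min (r / 8) (r / (8 * A))).
  by rewrite lt_min !divr_gt0 // mulr_gt0.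
move=> p w hp pw u; rewrite le_min => /andP[u1 u2].
have pw0 : p.[w] != 0.
  by rewrite -cmod_gt0 (lt_le_trans eta0) // hp // subrr cmod0 ltW.
have p0 : p != 0 by apply: contra pw0 => /eqP ->; rewrite horner0.
have [rs [_ Dp rts]] := poly_root_factor p0.
have rfar x : x \in rs -> r < cmod (x - w).
  move=> xrs; rewrite ltNge; apply/negP => /hp; rewrite rts // cmod0.
  by rewrite leNgt eta0.
have rne x : x \in rs -> x - w != 0.
  by move=> /rfar h; rewrite -cmod_gt0 (lt_trans r0).
set N := (size rs).+1.
pose T : {poly Cx R} :=
  \prod_(x <- rs) \sum_(k < N) ((x - w)^-1 ^+ k)%:P * 'X^k.
have TE z : T.[z] = \prod_(x <- rs) \sum_(k < N) (z / (x - w)) ^+ k.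
  rewrite horner_prod; apply: eq_bigr => x _.
  rewrite horner_sum; apply: eq_bigr => k _.
  by rewrite hornerCM hornerXn exprMn mulrC.
have key z : p.[z + w] * T.[z]
    = p.[w] * \prod_(x <- rs) (1 - (z / (x - w)) ^+ N).
  rewrite TE !Dp -!mulrA; congr (_ * _).
  rewrite -!big_split /= !big_seq; apply: eq_bigr => x /rne xw.
  have -> : 1 - (z / (x - w)) ^+ N
     = (1 - z / (x - w)) * \sum_(k < N) (z / (x - w)) ^+ k.
    by rewrite -[1 - _ ^+ N]opprB subrX1 -mulNr opprB.
  by rewrite mulrA; congr (_ * _); field.
have Pb z : cmod z <= r / 2 ->
    1 / 2 <= cmod (\prod_(x <- rs) (1 - (z / (x - w)) ^+ N)) <= 2.
  move=> hz.
  rewrite -(big_map (fun x => (z / (x - w)) ^+ N) predT (fun x => 1 - x)).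
  (* Each z / (x - w) has modulus at most 1/2, and 2^-N times the number of roots is at most 1/2. *)
  apply: (@prod_one_sub_bounds _ ((1 / 2) ^+ N)); first by rewrite exprn_ge0.
    rewrite size_map exprMn expr1n mul1r exprVn ler_pdivrMr ?exprn_gt0 //.
    rewrite /N exprS mulrA mulfVK ?pnatr_eq0 // mul1r -natrX ler_nat.
    by rewrite ltnW // ltn_expl.
  move=> _ /mapP[x xrs ->]; rewrite cmodX lerXn2r ?nnegrE ?cmod_ge0 //.
  rewrite cmodM cmodV ler_pdivrMr ?(lt_trans r0) ?rfar //.
  by have := rfar x xrs; lra.
have TA z : cmod (z - 0) <= r / 2 -> cmod T.[z] <= A.
  rewrite subr0 => hz; have /andP[_ P2] := Pb z hz.
  have hpz : eta <= cmod p.[z + w] by rewrite hp // addrK; lra.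
  rewrite ler_pdivlMr //.
  apply: (@le_trans _ _ (cmod (p.[z + w] * T.[z]))).
    by rewrite cmodM mulrC ler_wpM2r ?cmod_ge0.
  by rewrite key cmodM mulrC ler_pM ?cmod_ge0.
have T0 : T.[0] = 1.
  rewrite TE; apply: big1 => x _; rewrite big_ord_recl expr0 big1 ?addr0 // => i _.
  by rewrite mul0r expr0n.
have T1 : cmod (T.[u - w] - 1) <= 1 / 2.
  have r20 : 0 < r / 2 by rewrite divr_gt0.
  rewrite -T0 (le_trans (lipschitz_of_bound r20 TA _ _)) //.
  - by rewrite subr0; lra.
  - by rewrite subrr cmod0; lra.
  have c0 : 0 < 2 * A / (r / 2) by rewrite divr_gt0 // mulr_gt0.
  rewrite subr0 -ler_pdivlMl //.
  apply: le_trans u2 _; rewrite le_eqVlt; apply/orP; left; apply/eqP.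
  by field; rewrite !lt0r_neq0.
have T2 : 1 / 2 <= cmod T.[u - w].
  have := cmod_triangle T.[u - w] 1 0; rewrite !subr0 cmod1 cmodC.
  by move=> h; have := le_trans h (lerD T1 (lexx _)); lra.
have uw : cmod (u - w) <= r / 2 by lra.
have /andP[_ P2] := Pb _ uw.
have /(congr1 cmod) := key (u - w); rewrite subrK !cmodM.
move=> pE.
have h1 := ler_wpM2l (cmod_ge0 p.[u]) T2.
have h2 := ler_pM (cmod_ge0 p.[w]) (cmod_ge0 _) pw P2.
rewrite pE in h1; have h3 := le_trans h1 h2; lra.
Qed.

End Reciprocal.

(** * Fibered polynomial dynamics *)

Section FiberedDynamics.
Context {R : realType} {X : Type} (sg : X -> X).
Implicit Types (F H : X -> {poly Cx R}) (x : X) (u v w : Cx R).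

(** [F x] acts first, as in Q_z^n; over a one-point base these are the iterates of one
    polynomial. *)
Fixpoint fpoly F n x : {poly Cx R} :=
  if n is m.+1 then fpoly F m (sg x) \Po F x else 'X.

Definition forbit F n x w : Cx R := (fpoly F n x).[w].

Definition bounded_orbit F x w :=
  exists M : R, forall n, cmod (forbit F n x w) <= M.

(* The boundary of the fiber [bounded_orbit F x] when this fiber is closed. *)
Definition bdry F x w := bounded_orbit F x w /\
  forall r : R, 0 < r -> exists2 u, cmod (u - w) < r & ~ bounded_orbit F x u.

Definition escapes (rad : R) F :=
  forall x w, rad <= cmod w -> 2 * cmod w <= cmod (F x).[w].

(** Openness of the maps [F x], uniform in [x] and [w]; it provides the preimages along which orbits
    are pulled back. *)
Definition liftable F (e del : R) := forall x w y,
  cmod ((F x).[w] - y) <= del -> exists2 b, (F x).[b] = y & cmod (w - b) <= e.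

Lemma forbit0 F x w : forbit F 0 x w = w.
Proof. by rewrite /forbit hornerX. Qed.

Lemma forbitS F n x w : forbit F n.+1 x w = forbit F n (sg x) (F x).[w].
Proof. by rewrite /forbit /= horner_comp. Qed.

Lemma forbitD F n m x w :
  forbit F (n + m) x w = forbit F n (iter m sg x) (forbit F m x w).
Proof.
elim: m x w => [|m IH] x w; first by rewrite addn0 forbit0.
by rewrite addnS !forbitS IH iterSr.
Qed.

Lemma forbitSr F n x w :
  forbit F n.+1 x w = (F (iter n sg x)).[forbit F n x w].
Proof. by rewrite -add1n forbitD forbitS forbit0. Qed.

Lemma forbit_cont F n x w (e : R) : 0 < e -> exists2 del, 0 < del &
  forall u, cmod (u - w) < del -> cmod (forbit F n x u - forbit F n x w) < e.
Proof. exact: poly_cont. Qed.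

Lemma forbit_cont_upto F N x w (e : R) : 0 < e -> exists2 del, 0 < del &
  forall u, cmod (u - w) < del ->
  forall k, (k <= N)%N -> cmod (forbit F k x u - forbit F k x w) < e.
Proof.
move=> e0; elim: N => [|N [d d0 IH]].
  have [d d0 hd] := forbit_cont F 0 x w e0.
  by exists d => // u hu k; rewrite leqn0 => /eqP ->; exact: hd.
have [d' d'0 hd] := forbit_cont F N.+1 x w e0.
exists (Num.min d d'); first by rewrite lt_min d0.
move=> u; rewrite lt_min => /andP[h1 h2] k.
by rewrite leq_eqVlt => /orP[/eqP ->|/IH]; [exact: hd|apply].
Qed.

Lemma bounded_step F x w : bounded_orbit F (sg x) (F x).[w] <-> bounded_orbit F x w.
Proof.
split=> -[M hM].
  exists (Num.max (cmod w) M) => -[|n]; rewrite le_max ?forbit0 ?lexx //.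
  by rewrite forbitS hM orbT.
by exists M => n; rewrite -forbitS.
Qed.

Lemma bounded_iter F n x w :
  bounded_orbit F x w -> bounded_orbit F (iter n sg x) (forbit F n x w).
Proof.
move=> hw; elim: n => [|n IH]; first by rewrite forbit0.
by rewrite forbitSr iterS; apply/bounded_step.
Qed.

Lemma pow2_bounded_le0 (a M : R) : (forall n, 2 ^+ n * a <= M) -> a <= 0.
Proof.
move=> h; rewrite leNgt; apply/negP => a0.
have := h (Num.bound (M / a)); rewrite -ler_pdivlMr // leNgt.
by rewrite upper_nthrootP.
Qed.

Lemma escapes_iter rad F n x w : escapes rad F -> 0 < rad -> rad <= cmod w ->
  2 ^+ n * cmod w <= cmod (forbit F n x w).
Proof.
move=> hF rad0 hw; elim: n => [|n IH]; first by rewrite forbit0 mul1r.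
rewrite forbitSr exprS -mulrA.
have h1 : rad <= cmod (forbit F n x w).
  apply: le_trans hw (le_trans _ IH); rewrite ler_peMl ?cmod_ge0 //.
  by rewrite exprn_ege1 // ler1n.
by apply: le_trans (hF _ _ h1); rewrite ler_wpM2l.
Qed.

Lemma bounded_le rad F x w : escapes rad F -> 0 < rad ->
  bounded_orbit F x w -> cmod w <= rad.
Proof.
move=> hF rad0 [M hM]; rewrite leNgt; apply/negP => hw.
have : cmod w <= 0.
  apply: (@pow2_bounded_le0 _ M) => n.
  exact: le_trans (escapes_iter n x hF rad0 (ltW hw)) (hM n).
by rewrite leNgt (lt_trans rad0).
Qed.

Lemma bounded_forbit_le rad F n x w : escapes rad F -> 0 < rad ->
  bounded_orbit F x w -> cmod (forbit F n x w) <= rad.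
Proof. by move=> hF rad0 hw; apply: bounded_le hF rad0 (bounded_iter n hw). Qed.

(** Escape makes [rad] a bound common to all bounded orbits, and such a bound passes to limits. *)
Lemma bounded_closed rad F x w : escapes rad F -> 0 < rad ->
  (forall r : R, 0 < r -> exists2 u, cmod (u - w) < r & bounded_orbit F x u) ->
  bounded_orbit F x w.
Proof.
move=> hF rad0 hw; exists rad => n; apply/ler_addgt0Pr => e e0.
have [d d0 hd] := forbit_cont F n x w e0.
have [u ud ub] := hw d d0.
have := bounded_forbit_le n hF rad0 ub; have := hd u ud.
have := cmodB_ge (forbit F n x w) (forbit F n x u).
by rewrite [cmod (_ - forbit F n x u)]cmodC; lra.
Qed.

Lemma bdry_fwd F x w : bdry F x w -> bdry F (sg x) (F x).[w].
Proof.
move=> [hw far]; split; first exact/bounded_step.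
move=> r r0; have [d d0 hd] := poly_cont (F x) w r0.
have [u ud ub] := far d d0; exists (F x).[u]; first exact: hd.
by move=> /bounded_step.
Qed.

(** An unbounded orbit starting near F(w) lifts to one starting near w. *)
Lemma bdry_bwd F x w : (forall e, 0 < e -> exists2 del, 0 < del & liftable F e del) ->
  bdry F (sg x) (F x).[w] -> bdry F x w.
Proof.
move=> hF [/bounded_step hw far]; split=> // r r0.
have r20 : 0 < r / 2 by rewrite divr_gt0.
have [d d0 hd] := hF (r / 2) r20.
have [y yd yb] := far d d0.
have [|b by_ bw] := hd x w y; first by rewrite cmodC ltW.
exists b; first by rewrite cmodC (le_lt_trans bw) //; lra.
by move=> /bounded_step; rewrite by_.
Qed.

Lemma bdry_iter F n x w : bdry F x w -> bdry F (iter n sg x) (forbit F n x w).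
Proof.
move=> hw; elim: n => [|n IH]; first by rewrite forbit0.
by rewrite forbitSr iterS; apply: bdry_fwd.
Qed.

(** Surjectivity gives points [u n] whose n-th iterate is 0. Their first n iterates stay below
    [rad], since an escaping orbit never returns to 0, and a cluster point of the [u n] inherits the
    bound. *)
Lemma bounded_nonempty rad F x : escapes rad F -> 0 < rad ->
  (forall x y, exists b, (F x).[b] = y) -> exists w, bounded_orbit F x w.
Proof.
move=> hF rad0 sF.
have sFn n : exists u, forbit F n x u = 0.
  elim: n (x) => [|n IH] x'; first by exists 0; rewrite forbit0.
  have [u0 hu0] := IH (sg x'); have [u hu] := sF x' u0.
  by exists u; rewrite forbitS hu.
have [u hu] := choice sFn.
have ub n k : (k <= n)%N -> cmod (forbit F k x (u n)) <= rad.
  move=> kn; rewrite leNgt; apply/negP => hk.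
  have := escapes_iter (n - k) (iter k sg x) hF rad0 (ltW hk).
  rewrite -forbitD subnK // hu cmod0 leNgt mulr_gt0 ?exprn_gt0 //.
  exact: lt_trans hk.
have [|a ha] := @cluster_point _ u rad.
  by move=> n; have := ub n 0%N isT; rewrite forbit0.
exists a; exists rad => k; apply/ler_addgt0Pr => e e0.
have [d d0 hd] := forbit_cont F k x a e0.
have [n kn nd] := ha d d0 k.
have := ub n k kn; have := hd _ nd.
have := cmodB_ge (forbit F k x a) (forbit F k x (u n)).
by rewrite [cmod (_ - forbit F k x (u n))]cmodC; lra.
Qed.

(* A point of the fiber with maximal real part is a boundary point. *)
Lemma bdry_nonempty rad F x : escapes rad F -> 0 < rad ->
  (forall x y, exists b, (F x).[b] = y) -> exists w, bdry F x w.
Proof.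
move=> hF rad0 sF.
pose S : set R := [set complex.Re w | w in bounded_orbit F x].
have hS : has_sup S.
  split.
    by have [w hw] := bounded_nonempty x hF rad0 sF; exists (complex.Re w), w.
  exists rad => _ [w /(bounded_le hF rad0) hw <-].
  by apply: le_trans (ler_norm _) (le_trans (cmod_Re _) hw).
have approx n : exists w, bounded_orbit F x w /\
    sup S - n.+1%:R^-1 < complex.Re w.
  have e0 : 0 < n.+1%:R^-1 :> R by rewrite invr_gt0.
  by have [_ [w hw <-] h] := sup_adherent e0 hS; exists w.
have [u hu] := choice approx.
have [|a ha] := @cluster_point _ u rad.
  by move=> n; apply: bounded_le hF rad0 (hu n).1.
have aK : bounded_orbit F x a.
  apply: bounded_closed hF rad0 _ => r r0.
  by have [n _ hn] := ha r r0 0%N; exists (u n); last exact: (hu n).1.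
exists a; split=> // r r0; exists (a + (r / 2)%:C%C).
  by rewrite addrC addKr cmod_real gtr0_norm; lra.
move=> hb.
have le_sup : complex.Re (a + (r / 2)%:C%C) <= sup S.
  by apply: ub_le_sup; [case: hS|exists (a + (r / 2)%:C%C)].
have ReD (z z' : Cx R) : complex.Re (z + z') = complex.Re z + complex.Re z'.
  by case: z; case: z'.
move: le_sup; rewrite ReD /= => le_sup.
(* For large n, Re (u n) exceeds sup S - r/4 while u n is within r/4 of a; thus Re a > sup S - r/2,
   against [le_sup]. *)
have [n0 hn0] : exists n0 : nat, n0.+1%:R^-1 < r / 4.
  have r4 : 0 < r / 4 by rewrite divr_gt0.
  exists (Num.bound (r / 4)^-1); rewrite invf_plt ?posrE ?ltr0n //.
  rewrite (lt_trans (archi_boundP _)) ?invr_ge0 ?(ltW r4) //.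
  by rewrite ltr_nat.
have [n n0n hn] := ha (r / 4) (divr_gt0 r0 (ltr0Sn _ 3)) n0.
have h1 := (hu n).2.
have h2 : n.+1%:R^-1 <= n0.+1%:R^-1 :> R.
  by rewrite lef_pV2 ?posrE ?ltr0n // ler_nat.
have h3 := le_lt_trans (cmod_Re _) hn.
have ReN (z : Cx R) : complex.Re (- z) = - complex.Re z by case: z.
rewrite ReD ReN in h3.
move: h3; rewrite ltr_norml => /andP[_ h3].
move: h1 h2 hn0; move: (n.+1%:R^-1 : R) (n0.+1%:R^-1 : R) => s t h1 h2 h4.
by lra.
Qed.

End FiberedDynamics.

(** * Stability of expanding families *)

Section FiberConjugacy.
Context {R : realType} {X : Type} (sg : X -> X).

(** The conjugacy covers the identity of [X]: a change of base dynamics has to be absorbed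
    beforehand in the parametrization of the fibers of [G]. *)
Definition fiber_conjugate (F G : X -> {poly Cx R}) (tau : R) :=
  exists phi psi : X -> Cx R -> Cx R,
  [/\ forall x w, bdry sg F x w ->
        [/\ bdry sg G x (phi x w), psi x (phi x w) = w,
            cmod (phi x w - w) <= tau & phi (sg x) (F x).[w] = (G x).[phi x w]],
      forall x w, bdry sg G x w -> bdry sg F x (psi x w) /\ phi x (psi x w) = w,
      forall x w, bdry sg F x w -> forall e : R, 0 < e -> exists2 del, 0 < del &
        forall v, bdry sg F x v -> cmod (v - w) < del -> cmod (phi x v - phi x w) < e &
      forall x w, bdry sg G x w -> forall e : R, 0 < e -> exists2 del, 0 < del &
        forall v, bdry sg G x v -> cmod (v - w) < del -> cmod (psi x v - psi x w) < e].

End FiberConjugacy.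

Section Stability.
Context {R : realType} {X : Type} (sg : X -> X).
Implicit Types (H : X -> {poly Cx R}) (x : X) (u v w : Cx R).

Variables (F : X -> {poly Cx R}) (rad del0 del2 tau : R).
Hypotheses (rad1 : 1 <= rad) (del01 : del0 <= 1).
Hypotheses (tau0 : 0 < tau) (tau_del2 : 2 * tau <= del2) (tau_del0 : 8 * tau <= del0).

Local Ltac param_lra := move: rad1 del01 tau0 tau_del2 tau_del0 => *; lra.

(** Expansion is asked near the boundary of [F] even when [H] is a perturbation, whose own boundary
    is yet to be located. *)
Definition expands H := forall x w0 u v, bdry sg F x w0 ->
  cmod (u - w0) <= del0 -> cmod (v - w0) <= del0 ->
  2 * cmod (u - v) <= cmod ((H x).[u] - (H x).[v]).

Let del00 : 0 < del0.
Proof. param_lra. Qed.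

Let rad0 : 0 < rad.
Proof. param_lra. Qed.

Lemma near_expand H N x u v (c : nat -> Cx R) : expands H ->
  (forall n, (n <= N)%N -> [/\ bdry sg F (iter n sg x) (c n),
     cmod (forbit sg H n x u - c n) <= del0 &
     cmod (forbit sg H n x v - c n) <= del0]) ->
  2 ^+ N * cmod (u - v) <= cmod (forbit sg H N x u - forbit sg H N x v).
Proof.
move=> eH; elim: N => [|N IH] hc; first by rewrite !forbit0 mul1r.
have {}IH := IH (fun n nN => hc n (leqW nN)).
have [b1 b2 b3] := hc N (leqnSn N).
rewrite !forbitSr exprS -mulrA (le_trans _ (eH _ _ _ _ b1 b2 b3)) //.
by rewrite ler_wpM2l.
Qed.

(** The distance of the two orbits at least doubles at each step, yet never exceeds [2 * del0]. The
    points [c n] need not form an orbit. *)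
Lemma near_unique H x u v (c : nat -> Cx R) : expands H ->
  (forall n, [/\ bdry sg F (iter n sg x) (c n),
     cmod (forbit sg H n x u - c n) <= del0 &
     cmod (forbit sg H n x v - c n) <= del0]) -> u = v.
Proof.
move=> eH hc; apply/eqP; rewrite -subr_eq0 -cmod_eq0 eq_le cmod_ge0 andbT.
apply: (@pow2_bounded_le0 _ _ (2 * del0)) => n.
apply: le_trans (near_expand eH (fun k _ => hc k)) _.
have [_ h1 h2] := hc n.
by rewrite (le_trans (cmod_triangle (c n) _ _)) // [cmod (c n - _)]cmodC; param_lra.
Qed.

(** A disc of bounded orbits around w would make all iterates Lipschitz with one constant. A second
    orbit then stays in the region of expansion forever, and its distance to the first would have to
    grow like 2^n. *)
Lemma near_bdry H x w (c : nat -> Cx R) : expands H -> escapes rad H ->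
  bounded_orbit sg H x w ->
  (forall n, bdry sg F (iter n sg x) (c n) /\
     cmod (forbit sg H n x w - c n) <= del0 / 2) ->
  bdry sg H x w.
Proof.
move=> eH escH hw hc; split=> // r r0; apply: contrapT => nfar.
have ball_bd u : cmod (u - w) <= r / 2 -> bounded_orbit sg H x u.
  move=> hu; apply: contrapT => nu; apply: nfar; exists u => //.
  by apply: le_lt_trans hu _; param_lra.
have s0 : 0 < r / 2 by param_lra.
(* r / 8 is the range of [lipschitz_of_bound] for radius r / 2; the other bound, times the Lipschitz
   constant 4 rad / r, is [del0 / 2]. *)
pose t := Num.min (r / 8) (del0 * r / (8 * rad)).
have t0 : 0 < t by rewrite lt_min !divr_gt0 ?mulr_gt0.
have t1 : t <= r / 8 by rewrite ge_min lexx.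
have t2 : t <= del0 * r / (8 * rad) by rewrite ge_min lexx orbT.
pose u := w + t%:C%C.
have ut : cmod (u - w) = t by rewrite /u addrC addKr cmod_real gtr0_norm.
have close n : cmod (forbit sg H n x u - forbit sg H n x w) <= del0 / 2.
  apply: (@le_trans _ _ (2 * rad / (r / 2) * cmod (u - w))).
    apply: (@lipschitz_of_bound _ _ w rad (r / 2)) => //.
    - move=> z hz; exact: bounded_forbit_le escH rad0 (ball_bd z hz).
    - by rewrite ut; param_lra.
    - by rewrite subrr cmod0; param_lra.
  have c0 : 0 < 2 * rad / (r / 2) by rewrite divr_gt0 ?mulr_gt0.
  rewrite ut -ler_pdivlMl // (le_trans t2) // le_eqVlt; apply/orP; left.
  by apply/eqP; field; rewrite !lt0r_neq0.
suff : t <= 0 by rewrite leNgt t0.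
apply: (@pow2_bounded_le0 _ _ (del0 / 2)) => n.
rewrite -ut; apply: le_trans _ (close n).
apply: (@near_expand H n x u w c eH) => k _.
have [b1 b2] := hc k; split=> //; last by param_lra.
have := close k; have := cmod_triangle (forbit sg H k x w) (forbit sg H k x u) (c k).
param_lra.
Qed.

(** The shadow of the pseudo-orbit from its second point on is pulled back once: its error [tau]
    plus the jump [tau] is halved by the expansion, which restores [tau]. *)
Lemma shadow_upto H n x (v c : nat -> Cx R) : expands H ->
  liftable H (del0 / 2) del2 ->
  (forall k, [/\ bdry sg F (iter k sg x) (c k), cmod (v k - c k) <= del0 / 2 &
     cmod (v k.+1 - (H (iter k sg x)).[v k]) <= tau]) ->
  exists w, forall k, (k <= n)%N -> cmod (forbit sg H k x w - v k) <= tau.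
Proof.
move=> eH lH; elim: n x v c => [|n IH] x v c hv.
  exists (v 0%N) => k; rewrite leqn0 => /eqP ->.
  by rewrite forbit0 subrr cmod0 ltW.
have [|w1 hw1] := IH (sg x) (v \o S) (c \o S).
  by move=> k; rewrite -iterSr; exact: hv k.+1.
have [/= b0 v0 v1] := hv 0%N.
have h1 := hw1 0%N isT; rewrite forbit0 /= in h1.
have h2 : cmod (w1 - (H x).[v 0%N]) <= 2 * tau.
  by rewrite (le_trans (cmod_triangle (v 1%N) _ _)) //; param_lra.
have [|b bw1 bv] := lH x (v 0%N) w1; first by rewrite cmodC; param_lra.
have bc : cmod (b - c 0%N) <= del0.
  by rewrite (le_trans (cmod_triangle (v 0%N) _ _)) // cmodC; param_lra.
have := eH x (c 0%N) b (v 0%N) b0 bc; rewrite bw1 => hb.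
exists b => -[_|k kn]; last by rewrite forbitS bw1; exact: hw1.
by rewrite forbit0; have := hb ltac:(param_lra); param_lra.
Qed.

(** A cluster point of the finite shadows; the bound at each fixed time passes to the limit. *)
Lemma shadow H x (v c : nat -> Cx R) : expands H ->
  liftable H (del0 / 2) del2 ->
  (forall k, [/\ bdry sg F (iter k sg x) (c k), cmod (v k - c k) <= del0 / 2 &
     cmod (v k.+1 - (H (iter k sg x)).[v k]) <= tau]) ->
  exists w, forall k, cmod (forbit sg H k x w - v k) <= tau.
Proof.
move=> eH lH hv.
have [u hu] := choice (fun n => shadow_upto n eH lH hv).
have [|a ha] := @cluster_point _ u (tau + cmod (v 0%N)).
  move=> n; have := hu n 0%N isT; rewrite forbit0.
  by have := cmodB_ge (u n) (v 0%N); param_lra.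
exists a => k; apply/ler_addgt0Pr => e e0.
have [d d0 hd] := forbit_cont sg H k x a e0.
have [n kn nd] := ha d d0 k.
have := hu n k kn; have := hd _ nd.
have := cmod_triangle (forbit sg H k x (u n)) (forbit sg H k x a) (v k).
by rewrite [cmod (_ - forbit sg H k x (u n))]cmodC; param_lra.
Qed.

Variable G : X -> {poly Cx R}.
Hypotheses (escF : escapes rad F) (escG : escapes rad G).
Hypothesis surjF : forall x y, exists b, (F x).[b] = y.
Hypothesis liftF : forall e, 0 < e -> exists2 del, 0 < del & liftable F e del.
Hypotheses (liftF0 : liftable F (del0 / 2) del2) (liftG0 : liftable G (del0 / 2) del2).
Hypotheses (expF : expands F) (expG : expands G).
Hypothesis closeFG : forall x w, cmod w <= rad -> cmod ((F x).[w] - (G x).[w]) <= tau.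

Let far x w := forall b, bdry sg F x b -> tau <= cmod (w - b).

(** A boundary point near F(w) lifts to a boundary point near w, at distance at least [tau].
    Expansion doubles this distance, and replacing F by G costs at most [tau]. *)
Lemma far_step x w : far x w -> far (sg x) (G x).[w].
Proof.
move=> hw a ha.
have arad : cmod a <= rad by apply: bounded_le escF rad0 ha.1.
have [wrad|wrad] := leP (cmod w) rad; last first.
  have := escG x (ltW wrad); have := cmodB_ge (G x).[w] a; param_lra.
have h : 2 * tau <= cmod ((F x).[w] - a).
  have [hd|hd] := leP (cmod ((F x).[w] - a)) del2; last by param_lra.
  have [b ba bw] := liftF0 hd.
  have bb : bdry sg F x b by apply: bdry_bwd => //; rewrite ba.
  have := expF bb (u := w) (v := b); rewrite ba subrr cmod0.
  have := hw b bb => h1 h2; have := h2 ltac:(param_lra) ltac:(param_lra); param_lra.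
have := closeFG x wrad; have := cmod_triangle (G x).[w] (F x).[w] a; param_lra.
Qed.

Lemma far_iter n x w : far x w -> far (iter n sg x) (forbit sg G n x w).
Proof.
move=> hw; elim: n => [|n IH]; first by rewrite forbit0.
by rewrite forbitSr iterS; apply: far_step.
Qed.

(* The [G]-orbits of a small disc around a point far from the boundary of [F]
   all omit discs of radius [tau] centred on that boundary, hence are uniformly
   bounded as soon as one of them is. *)
Lemma bdry_near x w : bdry sg G x w ->
  exists2 b, bdry sg F x b & cmod (w - b) <= 2 * tau.
Proof.
move=> [hw wfar]; apply: contrapT => nex.
have ball_far u : cmod (u - w) <= tau -> far x u.
  move=> hu b hb; rewrite leNgt; apply/negP => h; apply: nex; exists b => //.
  have := cmod_triangle u w b; rewrite [cmod (w - u)]cmodC; param_lra.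
have ne y : exists b, bdry sg F y b by apply: bdry_nonempty escF rad0 surjF.
have r20 : 0 < 2 * rad by rewrite mulr_gt0.
have [r' r'0 hr'] := bounded_of_omitted_disc tau0 r20 tau0.
have [u ud nu] := wfar r' r'0; apply: nu.
(* The orbit of [w] is within [2 * rad] of [a], so that of [u] is within four times this, and |a| <=
   rad. *)
exists (9 * rad) => n; have [a ha] := ne (iter n sg x).
have arad : cmod a <= rad by apply: bounded_le escF rad0 ha.1.
have pE z : (fpoly sg G n x - a%:P).[z] = forbit sg G n x z - a.
  by rewrite !hornerE.
have := hr' (fpoly sg G n x - a%:P) w _ _ u (ltW ud); rewrite !pE.
have := cmodB_ge (forbit sg G n x u) a.
have := bounded_forbit_le n escG rad0 hw.
have := cmodD (forbit sg G n x w) (- a); rewrite cmodN => h1 h2 h3 h4.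
have {}h4 := h4 _ ltac:(param_lra).
suff: cmod (forbit sg G n x u - a) <= 4 * (2 * rad) by param_lra.
apply: h4 => z /ball_far hz; rewrite pE.
exact: far_iter hz _ ha.
Qed.

(** For v1 close to w1 the first N iterates agree up to [tau], those of the shadows up to [3 * tau],
    and expansion divides this by 2^N. Exchanging [H1] and [H2] treats a conjugacy and its inverse
    alike. *)
Lemma shadow_cont H1 H2 x w1 w2 (c : nat -> Cx R) (e : R) : expands H2 -> 0 < e ->
  (forall n, [/\ bdry sg F (iter n sg x) (c n), cmod (forbit sg H2 n x w2 - c n) <= tau
     & cmod (forbit sg H2 n x w2 - forbit sg H1 n x w1) <= tau]) ->
  exists2 del, 0 < del & forall v1 v2, cmod (v1 - w1) < del ->
   (forall n, cmod (forbit sg H2 n x v2 - forbit sg H1 n x v1) <= tau) ->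
   cmod (v2 - w2) < e.
Proof.
move=> eH e0 hc; pose N := Num.bound (3 * tau / e).
have [d d0 hd] := forbit_cont_upto sg H1 N x w1 tau0.
exists d => // v1 v2 /hd {}hd hv.
have h k : (k <= N)%N -> cmod (forbit sg H2 k x v2 - forbit sg H2 k x w2) <= 3 * tau.
  move=> /hd h1; have h2 := hv k; have [_ _ h3] := hc k.
  rewrite (le_trans (cmod_triangle (forbit sg H1 k x v1) _ _)) //.
  have := cmod_triangle (forbit sg H1 k x w1) (forbit sg H1 k x v1) (forbit sg H2 k x w2).
  by rewrite [cmod (forbit sg H1 k x w1 - _)]cmodC; param_lra.
have : 2 ^+ N * cmod (v2 - w2) <= 3 * tau.
  apply: le_trans (h N (leqnn N)); apply: (@near_expand H2 N x v2 w2 c) => // k kN.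
  have [b1 b2 _] := hc k; split=> //; last by param_lra.
  have := h k kN.
  have := cmod_triangle (forbit sg H2 k x w2) (forbit sg H2 k x v2) (c k); param_lra.
move=> hN; rewrite ltNge; apply/negP => ev.
have : 3 * tau / e < 2 ^+ N by rewrite upper_nthrootP.
rewrite ltr_pdivrMr // ltNge => /negP; apply.
by apply: le_trans hN; rewrite ler_wpM2l ?exprn_ge0.
Qed.

Theorem fiber_conjugacy : fiber_conjugate sg F G tau.
Proof.
(* The image is the start of the [G]-orbit shadowing the given [F]-orbit; off the boundary the
   default value 0 makes the choice total. *)
have ex_phi (xw : X * Cx R) : exists w', bdry sg F xw.1 xw.2 -> forall n,
    cmod (forbit sg G n xw.1 w' - forbit sg F n xw.1 xw.2) <= tau.
  case: xw => x w; have [hw|nw] := pselect (bdry sg F x w); last by exists 0.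
  have [|w' hw'] := @shadow G x (fun n => forbit sg F n x w) (fun n => forbit sg F n x w)
    expG liftG0; last by exists w'.
  move=> k; split; first exact: bdry_iter.
    by rewrite subrr cmod0; param_lra.
  by rewrite forbitSr closeFG // (bounded_forbit_le k escF rad0 hw.1).
have ex_psi (xw : X * Cx R) : exists w', bdry sg G xw.1 xw.2 -> forall n,
    cmod (forbit sg F n xw.1 w' - forbit sg G n xw.1 xw.2) <= tau.
  case: xw => x w; have [hw|nw] := pselect (bdry sg G x w); last by exists 0.
  (* A [G]-orbit is a pseudo-orbit of [F]; [bdry_near] places it in the region where [F] expands. *)
  have ex_c n : exists c, bdry sg F (iter n sg x) c /\ cmod (forbit sg G n x w - c) <= 2 * tau.
    by have [c] := bdry_near (bdry_iter n hw); exists c.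
  have [c hc] := choice ex_c.
  have [|w' hw'] := @shadow F x (fun n => forbit sg G n x w) c expF liftF0; last by exists w'.
  move=> k; have [c1 c2] := hc k; split=> //; first by param_lra.
  by rewrite forbitSr cmodC closeFG // (bounded_forbit_le k escG rad0 hw.1).
have [Phi hPhi] := choice ex_phi; have [Psi hPsi] := choice ex_psi.
pose phi x w := Phi (x, w); pose psi x w := Psi (x, w).
have phiP x w : bdry sg F x w -> forall n,
  cmod (forbit sg G n x (phi x w) - forbit sg F n x w) <= tau by exact: (hPhi (x, w)).
have psiP x w : bdry sg G x w -> forall n,
  cmod (forbit sg F n x (psi x w) - forbit sg G n x w) <= tau by exact: (hPsi (x, w)).
have phi_bdry x w : bdry sg F x w -> bdry sg G x (phi x w).
  move=> hw; apply: (@near_bdry G x _ (fun n => forbit sg F n x w)) => //.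
    exists (tau + rad) => n.
    have := phiP x w hw n; have := bounded_forbit_le n escF rad0 hw.1.
    have := cmodB_ge (forbit sg G n x (phi x w)) (forbit sg F n x w); param_lra.
  by move=> n; split; [exact: bdry_iter|have := phiP x w hw n; param_lra].
have psi_bdry x w : bdry sg G x w -> bdry sg F x (psi x w).
  move=> hw.
  have ex_c n : exists c, bdry sg F (iter n sg x) c /\ cmod (forbit sg G n x w - c) <= 2 * tau.
    by have [c] := bdry_near (bdry_iter n hw); exists c.
  have [c hc] := choice ex_c.
  apply: (@near_bdry F x _ c) => //.
    exists (tau + rad) => n.
    have := psiP x w hw n; have := bounded_forbit_le n escG rad0 hw.1.
    have := cmodB_ge (forbit sg F n x (psi x w)) (forbit sg G n x w); param_lra.
  move=> n; have [c1 c2] := hc n; split=> //.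
  have := psiP x w hw n.
  have := cmod_triangle (forbit sg G n x w) (forbit sg F n x (psi x w)) (c n); param_lra.
(* Both sides have [G]-orbits close to the [F]-orbit of [psi x w], so uniqueness of shadows
   applies. *)
have phi_psi x w : bdry sg G x w -> phi x (psi x w) = w.
  move=> hw; have hw' := psi_bdry x w hw.
  apply: (@near_unique G x _ _ (fun n => forbit sg F n x (psi x w))) => // n.
  split; first exact: bdry_iter.
    by have := phiP x _ hw' n; param_lra.
  by rewrite cmodC; have := psiP x w hw n; param_lra.
have psi_phi x w : bdry sg F x w -> psi x (phi x w) = w.
  move=> hw; have hw' := phi_bdry x w hw.
  apply: (@near_unique F x _ _ (fun n => forbit sg F n x w)) => // n.
  split; first exact: bdry_iter; last by rewrite subrr cmod0 ltW.
  have := phiP x w hw n; have := psiP x _ hw' n.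
  have := cmod_triangle (forbit sg G n x (phi x w)) (forbit sg F n x (psi x (phi x w)))
    (forbit sg F n x w); param_lra.
exists phi, psi; split.
- move=> x w hw; split; [exact: phi_bdry|exact: psi_phi| |].
    by have := phiP x w hw 0%N; rewrite !forbit0.
  have hw' := bdry_fwd hw.
  apply: (@near_unique G (sg x) _ _ (fun n => forbit sg F n (sg x) (F x).[w])) => // n.
  split; first exact: bdry_iter.
    by have := phiP _ _ hw' n; param_lra.
  by rewrite -!forbitS; have := phiP _ _ hw n.+1; param_lra.
- by move=> x w hw; split; [exact: psi_bdry|exact: phi_psi].
- move=> x w hw e e0.
  have [|d d0 hd] := @shadow_cont F G x w (phi x w) (fun n => forbit sg F n x w) e expG e0.
    by move=> n; split; [exact: bdry_iter|exact: phiP|exact: phiP].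
  by exists d => // v hv vd; apply: (hd v) => //; exact: phiP.
- move=> x w hw e e0.
  have [|d d0 hd] := @shadow_cont G F x w (psi x w)
    (fun n => forbit sg F n x (psi x w)) e expF e0.
    move=> n; split; [exact/bdry_iter/psi_bdry| |exact: psiP].
    by rewrite subrr cmod0 ltW.
  by exists d => // v hv vd; apply: (hd v) => //; exact: psiP.
Qed.

End Stability.

Section Perturbation.
Context {R : realType} {X : Type} (sg : X -> X).

(** The lifting modulus [op] and the radius [rad] are shared by [F] and its perturbations, so that
    [tau] can be fixed before [G]. *)
Theorem fiber_stability (F : X -> {poly Cx R}) (rad A tau0 : R) (op : R -> R) :
  1 <= rad -> escapes rad F -> (forall x y, exists b, (F x).[b] = y) ->
  (forall e, 0 < e -> 0 < op e) -> (forall e, 0 < e -> liftable F e (op e)) ->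
  0 <= A -> (forall x w, cmod w <= rad + 1 -> cmod (F x).[w] <= A) ->
  (forall x w, bdry sg F x w -> 4 <= cmod (F x)^`().[w]) -> 0 < tau0 ->
  exists2 tau, 0 < tau & forall G : X -> {poly Cx R}, escapes rad G ->
    (forall e, 0 < e -> liftable G e (op e)) ->
    (forall x w, cmod w <= rad + 1 -> cmod ((F x).[w] - (G x).[w]) <= tau) ->
    fiber_conjugate sg F G tau0.
Proof.
move=> rad1 escF surjF op0 liftF A0 hA dF tau00.
have rad0 : 0 < rad by lra.
have A1 : 0 < 4 * A + 4 by lra.
(* The Taylor error 4 A del0 |u - v| is then at most |u - v|, which lowers the factor 4 of the
   derivative to 3 for [F]. *)
pose del0 := (4 * A + 4)^-1.
have del00 : 0 < del0 by rewrite invr_gt0.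
have del0A : del0 * (4 * A + 4) = 1 by rewrite mulVf // lt0r_neq0.
have del04 : 4 * del0 <= 1 by nra.
have Adel0 : 4 * A * del0 <= 1 by nra.
have del02 : 0 < del0 / 2 by lra.
set del2 := op (del0 / 2); have del20 : 0 < del2 by apply: op0.
pose tau := Num.min (Num.min tau0 (del2 / 2)) (Num.min (del0 / 8) (1 / 2)).
have : tau <= tau by [].
rewrite {2}/tau !le_min => /andP[/andP[t1 t2] /andP[t3 t4]].
have tau_gt0 : 0 < tau by rewrite !lt_min tau00 /=; apply/and3P; split; lra.
exists tau => // G escG liftG close.
have near_rad x w z : bdry sg F x w -> cmod (z - w) <= 1 -> cmod z <= rad + 1.
  move=> /proj1/(bounded_le escF rad0) h1 h2.
  by have := cmodB_ge z w; lra.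
have sepF x w0 u v : bdry sg F x w0 -> cmod (u - w0) <= del0 ->
    cmod (v - w0) <= del0 -> 3 * cmod (u - v) <= cmod ((F x).[u] - (F x).[v]).
  move=> hw0 hu hv.
  have [||_] := @taylor_bound _ (F x) w0 A 1 del0 u v ltr01 _ _ hu hv.
  - by move=> z hz; apply: hA; exact: near_rad hw0 hz.
  - by [].
  rewrite expr1n divr1 => h.
  have h1 : 4 * cmod (u - v) <= cmod ((F x)^`().[w0] * (u - v)).
    by rewrite cmodM ler_wpM2r ?cmod_ge0 // dF.
  have h2 : 4 * A * del0 * cmod (u - v) <= cmod (u - v).
    by rewrite ler_piMl ?cmod_ge0.
  have := cmodB_ge ((F x)^`().[w0] * (u - v)) ((F x).[u] - (F x).[v]).
  by rewrite [cmod (_ - ((F x).[u] - _))]cmodC; lra.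
(* F - G is bounded by [tau] on unit discs, hence Lipschitz with constant 2 tau <= 1; this lowers
   the factor from 3 to 2. *)
have sepG x w0 u v : bdry sg F x w0 -> cmod (u - w0) <= del0 ->
    cmod (v - w0) <= del0 -> 2 * cmod (u - v) <= cmod ((G x).[u] - (G x).[v]).
  move=> hw0 hu hv; have h1 := sepF x w0 u v hw0 hu hv.
  have h : cmod ((F x).[u] - (G x).[u] - ((F x).[v] - (G x).[v]))
      <= 2 * tau * cmod (u - v).
    have := @lipschitz_of_bound _ (F x - G x) w0 tau 1 u v ltr01.
    rewrite !hornerE divr1; apply; [|lra|lra].
    by move=> z hz; rewrite !hornerE; apply: close; exact: near_rad hw0 hz.
  have h2 : 2 * tau * cmod (u - v) <= cmod (u - v).
    by rewrite ler_piMl ?cmod_ge0 //; lra.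
  have := cmodB_ge ((F x).[u] - (F x).[v]) ((G x).[u] - (G x).[v]).
  have -> : (F x).[u] - (F x).[v] - ((G x).[u] - (G x).[v])
    = (F x).[u] - (G x).[u] - ((F x).[v] - (G x).[v]) by ring.
  by lra.
have expF : expands sg F del0 F.
  by move=> x w0 u v b1 b2 b3; have := sepF x w0 u v b1 b2 b3;
    have := cmod_ge0 (u - v); lra.
have liftF' e : 0 < e -> exists2 del, 0 < del & liftable F e del.
  by move=> e0; exists (op e); [exact: op0|exact: liftF].
have close' x w : cmod w <= rad -> cmod ((F x).[w] - (G x).[w]) <= tau.
  by move=> hw; apply: close; lra.
have [|||phi [psi [h1 h2 h3 h4]]] := fiber_conjugacy rad1 _ tau_gt0 _ _ escF escG
  surjF liftF' (liftF _ del02) (liftG _ del02) expF sepG close'.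
- by lra.
- by rewrite -/del2; lra.
- by lra.
exists phi, psi; split=> // x w /h1[b1 b2 b3 b4]; split=> //; lra.
Qed.

End Perturbation.

(** * Dependence of the iterates on the coefficients *)

Section CoefficientDependence.
Context {R : realType} (d : nat).
Implicit Types (f g h : coeffs R d) (z w : Cx R).

Definition near_coeffs (del : R) g h :=
  (forall i, cmod (g.1 ord0 i - h.1 ord0 i) <= del) /\
  (forall i j, cmod (g.2 i j - h.2 i j) <= del).

(* Local boundedness at the parameter [g], and uniform continuity at [g] on
   bounded sets of (z, w). *)
Definition loc_unif_cont g (Phi : coeffs R d -> Cx R -> Cx R -> Cx R) :=
  (forall rho : R, exists2 A, 0 <= A & forall z w,
     cmod z <= rho -> cmod w <= rho -> cmod (Phi g z w) <= A) /\
  (forall rho e : R, 0 < e -> exists2 del, 0 < del & forall h z z' w w',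
     near_coeffs del g h -> cmod z <= rho -> cmod w <= rho ->
     cmod (z - z') <= del -> cmod (w - w') <= del ->
     cmod (Phi g z w - Phi h z' w') <= e).

Lemma near_coeffsW (del del' : R) g h : del <= del' ->
  near_coeffs del g h -> near_coeffs del' g h.
Proof. by move=> le [h1 h2]; split=> *; apply: le_trans le. Qed.

Variable g : coeffs R d.
Local Notation luc := (loc_unif_cont g).

Lemma luc_base : luc (fun _ z _ => z).
Proof.
split=> [rho|rho e e0]; last by exists e.
by exists `|rho| => // z w zr _; rewrite (le_trans zr) // ler_norm.
Qed.

Lemma luc_fiber : luc (fun _ _ w => w).
Proof.
split=> [rho|rho e e0]; last by exists e.
by exists `|rho| => // z w _ wr; rewrite (le_trans wr) // ler_norm.
Qed.

Lemma luc_cst c : luc (fun _ _ _ => c).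
Proof.
split=> [rho|rho e e0]; first by exists (cmod c); rewrite ?cmod_ge0.
by exists 1 => // *; rewrite subrr cmod0 ltW.
Qed.

Lemma luc_coef1 i : luc (fun h _ _ => h.1 ord0 i).
Proof.
split=> [rho|rho e e0]; first by exists (cmod (g.1 ord0 i)); rewrite ?cmod_ge0.
by exists e => // h z z' w w' [h1 _] *; exact: h1.
Qed.

Lemma luc_coef2 i j : luc (fun h _ _ => h.2 i j).
Proof.
split=> [rho|rho e e0]; first by exists (cmod (g.2 i j)); rewrite ?cmod_ge0.
by exists e => // h z z' w w' [_ h1] *; exact: h1.
Qed.

(** The local bounds of the inner functions give the radius at which the continuity of [Phi] is
    used. *)
Lemma luc_comp Phi Psi1 Psi2 : luc Phi -> luc Psi1 -> luc Psi2 ->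
  luc (fun h z w => Phi h (Psi1 h z w) (Psi2 h z w)).
Proof.
move=> [bP cP] [b1 c1] [b2 c2]; split=> [rho|rho e e0].
  have [A1 A10 h1] := b1 rho; have [A2 A20 h2] := b2 rho.
  have [A A0 hA] := bP (Num.max A1 A2); exists A => // z w zr wr.
  by apply: hA; rewrite le_max ?h1 ?h2 ?orbT.
have [A1 A10 h1] := b1 rho; have [A2 A20 h2] := b2 rho.
have [del del0 hd] := cP (Num.max A1 A2) e e0.
have [d1 d10 hd1] := c1 rho del del0; have [d2 d20 hd2] := c2 rho del del0.
pose del' := Num.min del (Num.min d1 d2).
have [l0 l1 l2] : [/\ del' <= del, del' <= d1 & del' <= d2].
  by split; rewrite /del' !ge_min lexx ?orbT.
exists del'; first by rewrite !lt_min del0 d10.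
move=> h z z' w w' gh zr wr zz ww.
apply: hd; first exact: near_coeffsW gh.
- by rewrite le_max h1.
- by rewrite le_max h2 ?orbT.
- by apply: hd1 => //; [exact: near_coeffsW gh|exact: le_trans l1|exact: le_trans l1].
- by apply: hd2 => //; [exact: near_coeffsW gh|exact: le_trans l2|exact: le_trans l2].
Qed.

Lemma luc_add Phi Psi : luc Phi -> luc Psi -> luc (fun h z w => Phi h z w + Psi h z w).
Proof.
move=> [b1 c1] [b2 c2]; split=> [rho|rho e e0].
  have [A1 A10 h1] := b1 rho; have [A2 A20 h2] := b2 rho.
  exists (A1 + A2); first by rewrite addr_ge0.
  by move=> z w zr wr; rewrite (le_trans (cmodD _ _)) // lerD ?h1 ?h2.
have e20 : 0 < e / 2 by rewrite divr_gt0.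
have [d1 d10 hd1] := c1 rho _ e20; have [d2 d20 hd2] := c2 rho _ e20.
pose del' := Num.min d1 d2.
have [l1 l2] : del' <= d1 /\ del' <= d2 by split; rewrite ge_min lexx ?orbT.
exists del'; first by rewrite lt_min d10.
move=> h z z' w w' gh zr wr zz ww.
rewrite opprD addrACA (le_trans (cmodD _ _)) // [e]splitr lerD //.
- by apply: hd1 => //; [exact: near_coeffsW gh|exact: le_trans l1|exact: le_trans l1].
- by apply: hd2 => //; [exact: near_coeffsW gh|exact: le_trans l2|exact: le_trans l2].
Qed.

Lemma luc_mul Phi Psi : luc Phi -> luc Psi -> luc (fun h z w => Phi h z w * Psi h z w).
Proof.
move=> [b1 c1] [b2 c2]; split=> [rho|rho e e0].
  have [A1 A10 h1] := b1 rho; have [A2 A20 h2] := b2 rho.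
  exists (A1 * A2); first by rewrite mulr_ge0.
  by move=> z w zr wr; rewrite cmodM ler_pM ?cmod_ge0 ?h1 ?h2.
have [A1 A10 h1] := b1 rho; have [A2 A20 h2] := b2 rho.
(* If both factors vary by at most e1 <= 1, the product varies by at most e1 (A1 + A2 + e1). *)
pose e1 := Num.min 1 (e / (A1 + A2 + 1)).
have s0 : 0 < A1 + A2 + 1 by rewrite ltr_wpDl ?addr_ge0.
have e10 : 0 < e1 by rewrite lt_min ltr01 divr_gt0.
have e11 : e1 <= 1 by rewrite ge_min lexx.
have e1e : e1 * (A1 + A2 + 1) <= e by rewrite -ler_pdivlMr // ge_min lexx orbT.
have [d1 d10 hd1] := c1 rho _ e10; have [d2 d20 hd2] := c2 rho _ e10.
pose del' := Num.min d1 d2.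
have [l1 l2] : del' <= d1 /\ del' <= d2 by split; rewrite ge_min lexx ?orbT.
exists del'; first by rewrite lt_min d10.
move=> h z z' w w' gh zr wr zz ww.
have k1 : cmod (Phi g z w - Phi h z' w') <= e1.
  by apply: hd1 => //; [exact: near_coeffsW gh|exact: le_trans l1|exact: le_trans l1].
have k2 : cmod (Psi g z w - Psi h z' w') <= e1.
  by apply: hd2 => //; [exact: near_coeffsW gh|exact: le_trans l2|exact: le_trans l2].
have {}h1 := h1 z w zr wr; have {}h2 := h2 z w zr wr.
move: (Phi g z w) (Phi h z' w') (Psi g z w) (Psi h z' w') h1 h2 k1 k2.
move=> a a' b b' ha hb haa hbb.
have -> : a * b - a' * b' = a * (b - b') + (a - a') * b - (a - a') * (b - b') by ring.
apply: le_trans e1e; rewrite (le_trans (cmodD _ _)) // cmodN.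
have := cmodD (a * (b - b')) ((a - a') * b); rewrite !cmodM.
have := ler_pM (cmod_ge0 _) (cmod_ge0 _) ha hbb.
have := ler_pM (cmod_ge0 _) (cmod_ge0 _) haa hb.
have := ler_pM (cmod_ge0 _) (cmod_ge0 _) haa hbb.
nra.
Qed.

Lemma luc_sum n (Phi : 'I_n -> coeffs R d -> Cx R -> Cx R -> Cx R) :
  (forall i, luc (Phi i)) -> luc (fun h z w => \sum_(i < n) Phi i h z w).
Proof.
elim: n Phi => [|n IH] Phi hPhi.
  suff -> : (fun h z w => \sum_(i < 0) Phi i h z w) = fun _ _ _ => 0 by exact: luc_cst.
  by apply/funext => h; apply/funext => z; apply/funext => w; rewrite big_ord0.
have -> : (fun h z w => \sum_(i < n.+1) Phi i h z w)
   = fun h z w => Phi ord0 h z w + \sum_(i < n) Phi (lift ord0 i) h z w.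
  by apply/funext => h; apply/funext => z; apply/funext => w; rewrite big_ord_recl.
by apply: luc_add => //; apply: IH.
Qed.

Lemma luc_exp Phi n : luc Phi -> luc (fun h z w => Phi h z w ^+ n).
Proof.
move=> hPhi; elim: n => [|n IH]; first exact: luc_cst.
have -> : (fun h z w => Phi h z w ^+ n.+1) = fun h z w => Phi h z w * Phi h z w ^+ n.
  by apply/funext => h; apply/funext => z; apply/funext => w; rewrite exprS.
exact: luc_mul.
Qed.

Lemma horner_base_poly f z :
  (base_poly f).[z] = \sum_(i < d.+1) f.1 ord0 i * z ^+ i.
Proof.
rewrite (@horner_coef_wide _ d.+1) ?size_poly //.
by apply: eq_bigr => i _; rewrite coef_rVpoly_ord.
Qed.

Lemma horner_fiber_poly f z w :
  (fiber_poly f z).[w] = \sum_(i < d.+1) \sum_(j < d.+1) f.2 i j * z ^+ i * w ^+ j.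
Proof.
rewrite horner_sum; apply: eq_bigr => i _.
rewrite horner_sum; apply: eq_bigr => j _.
by rewrite hornerZ hornerXn.
Qed.

Lemma luc_base_poly : luc (fun h z _ => (base_poly h).[z]).
Proof.
have -> : (fun h z _ => (base_poly h).[z])
    = fun h z (w : Cx R) => \sum_(i < d.+1) h.1 ord0 i * z ^+ i.
  by apply/funext => h; apply/funext => z; apply/funext => w; rewrite horner_base_poly.
apply: luc_sum => i; apply: luc_mul; first exact: luc_coef1.
exact: luc_exp luc_base.
Qed.

Lemma luc_fiber_poly : luc (fun h z w => (fiber_poly h z).[w]).
Proof.
have -> : (fun h z w => (fiber_poly h z).[w])
    = fun h z w => \sum_(i < d.+1) \sum_(j < d.+1) h.2 i j * z ^+ i * w ^+ j.
  by apply/funext => h; apply/funext => z; apply/funext => w; rewrite horner_fiber_poly.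
apply: luc_sum => i; apply: luc_sum => j; apply: luc_mul; last exact: luc_exp luc_fiber.
apply: luc_mul; first exact: luc_coef2.
exact: luc_exp luc_base.
Qed.

Lemma luc_base_iter n : luc (fun h z _ => iter n (horner (base_poly h)) z).
Proof.
elim: n => [|n IH]; first exact: luc_base.
exact: (luc_comp luc_base_poly IH luc_fiber).
Qed.

Lemma luc_fiber_iter n : luc (fun h z w => (fiber_iter h n z).[w]).
Proof.
elim: n => [|n IH].
  suff -> : (fun h z w => (fiber_iter h 0 z).[w]) = fun _ _ w => w by exact: luc_fiber.
  by apply/funext => h; apply/funext => z; apply/funext => w; rewrite hornerX.
have -> : (fun h z w => (fiber_iter h n.+1 z).[w])
  = fun h z w => (fiber_iter h n (base_poly h).[z]).[(fiber_poly h z).[w]].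
  by apply/funext => h; apply/funext => z; apply/funext => w; rewrite horner_comp.
exact: (luc_comp IH luc_base_poly luc_fiber_poly).
Qed.

End CoefficientDependence.

(** * Escape radii and leading coefficients, uniformly in the parameter *)

Section BoundedCoefficients.
Context {R : realType} (d : nat).
Hypothesis d2 : (2 <= d)%N.
Implicit Types (p : {poly Cx R}) (f g h : coeffs R d) (z w : Cx R) (m M : R).

Definition admissible m M p :=
  [/\ (size p <= d.+1)%N, m <= cmod p`_d & forall j, cmod p`_j <= M].

Definition escape_radius m M : R := 1 + (d%:R * M + 2) / m.

Lemma escape_radius_gt1 m M : 0 < m -> 0 <= M -> 1 < escape_radius m M.
Proof. by move=> m0 M0; rewrite ltrDl divr_gt0 // ltr_wpDl // mulr_ge0. Qed.

(** The leading term has modulus at least m |w|^d, the others add up to at most d M |w|^(d-1); the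
    radius makes the difference at least 2 |w|^(d-1), which is at least 2 |w| as d >= 2. *)
Lemma admissible_escape m M p w : 0 < m -> 0 <= M -> admissible m M p ->
  escape_radius m M <= cmod w -> 2 * cmod w <= cmod p.[w].
Proof.
move=> m0 M0 [szp hm hM] hw.
have w1 : 1 <= cmod w by apply: le_trans hw; rewrite ltW // escape_radius_gt1.
have hw2 : d%:R * M + 2 <= m * cmod w.
  rewrite [leRHS]mulrC -(ler_pdivrMr _ _ m0); apply: le_trans hw.
  by rewrite /escape_radius lerDr.
rewrite (horner_coef_wide _ szp) big_ord_recr /= addrC.
set S := \sum_(i < d) _.
have hS : cmod S <= d%:R * M * cmod w ^+ d.-1.
  apply: le_trans (cmod_sum _ _ _) _.
  apply: (@le_trans _ _ (\sum_(i < d) M * cmod w ^+ d.-1)); last first.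
    by rewrite sumr_const card_ord -[leLHS]mulr_natl mulrA.
  apply: ler_sum => i _; rewrite cmodM cmodX ler_pM ?exprn_ge0 ?cmod_ge0 //=.
  by rewrite ler_weXn2l // -ltnS prednK ?ltn_ord // ltnW.
have h1 : m * cmod w ^+ d <= cmod (p`_d * w ^+ d).
  by rewrite cmodM cmodX ler_wpM2r ?exprn_ge0 ?cmod_ge0.
have h2 := cmodB_ge (p`_d * w ^+ d) (- S); rewrite cmodN opprK in h2.
have h3 : cmod w <= cmod w ^+ d.-1.
  by rewrite -{1}[cmod w]expr1 ler_weXn2l // -ltnS prednK // ltnW.
have wd : cmod w ^+ d = cmod w * cmod w ^+ d.-1 by rewrite -exprS prednK // ltnW.
have h4 : 2 * cmod w ^+ d.-1 <= (m * cmod w - d%:R * M) * cmod w ^+ d.-1.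
  by rewrite ler_wpM2r ?exprn_ge0 ?cmod_ge0 //; lra.
rewrite wd in h1; rewrite mulrBl in h4; rewrite mulrA in h1.
by lra.
Qed.

(** The entry [(ord0, ord_max)] is the coefficient of w^d in q; by the last clause it is the leading
    coefficient of every q_z. *)
Definition bounded_coeffs m M h :=
  [/\ m <= cmod (h.1 ord0 ord_max), m <= cmod (h.2 ord0 ord_max),
      forall i, cmod (h.1 ord0 i) <= M, forall i j, cmod (h.2 i j) <= M &
      forall i j : 'I_d.+1, (d < i + j)%N -> h.2 i j = 0].

Lemma base_admissible m M h : 0 <= M -> bounded_coeffs m M h ->
  admissible m M (base_poly h).
Proof.
move=> M0 [h1 _ h2 _ _]; split; first by rewrite size_poly.
  by have := coef_rVpoly_ord h.1 (@ord_max d) => /= ->.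
move=> j; rewrite coef_poly; case: ifP => _; last by rewrite cmod0.
by case: insub => [i|]; rewrite ?cmod0.
Qed.

Lemma coef_fiber_poly h z (j : 'I_d.+1) :
  (fiber_poly h z)`_j = \sum_(i < d.+1) h.2 i j * z ^+ i.
Proof.
rewrite coef_sum; apply: eq_bigr => i _; rewrite coef_sum (bigD1 j) //= big1.
  by rewrite coefZ coefXn eqxx mulr1 addr0.
by move=> k; rewrite -val_eqE /= => kj; rewrite coefZ coefXn eq_sym (negbTE kj) mulr0.
Qed.

Lemma size_fiber_poly h z : (size (fiber_poly h z) <= d.+1)%N.
Proof.
apply: (leq_trans (size_sum _ _ _)); apply/bigmax_leqP => i _.
apply: (leq_trans (size_sum _ _ _)); apply/bigmax_leqP => j _.
by rewrite (leq_trans (size_scale_leq _ _)) // size_polyXn ltn_ord.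
Qed.

Lemma lead_fiber_poly h z : (forall i j : 'I_d.+1, (d < i + j)%N -> h.2 i j = 0) ->
  (fiber_poly h z)`_d = h.2 ord0 ord_max.
Proof.
move=> h0; have := coef_fiber_poly h z ord_max => /= ->.
rewrite big_ord_recl expr0 mulr1 big1 ?addr0 // => i _.
by rewrite h0 ?mul0r // lift0 /=; lia.
Qed.

Lemma fiber_admissible m M rho h z : 0 <= M -> 1 <= rho -> cmod z <= rho ->
  bounded_coeffs m M h -> admissible m (d.+1%:R * (M * rho ^+ d)) (fiber_poly h z).
Proof.
move=> M0 rho1 zr [_ h1 _ h2 h3].
split; [exact: size_fiber_poly|by rewrite lead_fiber_poly|move=> j].
have b0 : 0 <= d.+1%:R * (M * rho ^+ d) by rewrite !mulr_ge0 // exprn_ge0 //; lra.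
have [jd|jd] := ltnP j d.+1; last first.
  by rewrite nth_default ?cmod0 // (leq_trans (size_fiber_poly _ _)).
have -> : j = Ordinal jd by [].
rewrite coef_fiber_poly (le_trans (cmod_sum _ _ _)) //.
apply: (@le_trans _ _ (\sum_(i < d.+1) M * rho ^+ d)); last first.
  by rewrite sumr_const card_ord -[leLHS]mulr_natl.
apply: ler_sum => i _; rewrite cmodM cmodX ler_pM ?cmod_ge0 ?exprn_ge0 ?cmod_ge0 //.
apply: (@le_trans _ _ (rho ^+ i)).
  by rewrite lerXn2r ?nnegrE ?cmod_ge0 // (le_trans _ zr) ?cmod_ge0.
by rewrite ler_weXn2l // -ltnS.
Qed.

(** On the line t = 0: without the term w^d the homogenization vanishes at (0, 1, 0); with it but
    without z^d, it vanishes at (1, w, 0) for a root w of the top homogeneous part of q at z = 1. *)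
Lemma skew_product_lead h : is_skew_product h ->
  h.1 ord0 ord_max != 0 /\ h.2 ord0 ord_max != 0.
Proof.
move=> [hdeg hom].
have top z w : homogenization h z w 0 = (h.1 ord0 ord_max * z ^+ d,
    \sum_(i < d.+1) h.2 i (rev_ord i) * z ^+ i * w ^+ (d - i), 0).
  rewrite /homogenization expr0n; have -> : (d == 0)%N = false by lia.
  congr (_, _, _).
    rewrite big_ord_recr big1 /= ?add0r ?subnn ?expr0 ?mulr1 // => i _.
    rewrite expr0n; have -> : (d - i == 0)%N = false by have := ltn_ord i; lia.
    by rewrite mulr0.
  apply: eq_bigr => i _; rewrite (bigD1 (rev_ord i)) /=; last first.
    by have := ltn_ord i; lia.
  have id := ltn_ord i.
  rewrite big1 => [|j /andP[jd ji]].
    rewrite addr0 subSS subnKC ?subnn ?expr0 ?mulr1 //; lia.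
  rewrite [0 ^+ _]expr0n; have -> : (d - (i + j) == 0)%N = false; last by rewrite mulr0.
  apply/negbTE; apply: contra ji => /eqP h0; apply/eqP/val_inj => /=; lia.
have b0 : h.2 ord0 ord_max != 0.
  apply/eqP => b0; have [|_ /eqP] := hom 0 1 0; last by rewrite oner_eq0.
  rewrite top expr0n; have -> : (d == 0)%N = false by lia.
  rewrite mulr0 big_ord_recl big1 ?addr0 => [|i _].
    by rewrite (_ : rev_ord ord0 = ord_max) ?b0 ?mul0r //; apply: val_inj => /=; lia.
  by rewrite lift0 expr0n mulr0 mul0r.
split=> //; apply/eqP => a0.
pose q : {poly Cx R} := \sum_(i < d.+1) h.2 i (rev_ord i) *: 'X^(d - i).
have qd : q`_d = h.2 ord0 ord_max.
  rewrite coef_sum big_ord_recl big1 ?addr0 => [|i _].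
    rewrite coefZ coefXn subn0 eqxx mulr1; congr (h.2 _ _).
    by apply: val_inj => /=; lia.
  rewrite coefZ coefXn lift0; have -> : (d == d - i.+1)%N = false by lia.
  by rewrite mulr0.
have szq : (size q <= d.+1)%N.
  apply: (leq_trans (size_sum _ _ _)); apply/bigmax_leqP => i _.
  by rewrite (leq_trans (size_scale_leq _ _)) // size_polyXn; lia.
have bpos : 0 < cmod (h.2 ord0 ord_max) by rewrite cmod_gt0.
(* Only the existence of a root matters: the radius e >= 1 is so large that |q(0)| is at most the
   leading modulus times e, hence times e^d. *)
have [|||w qw _] := @root_nearby _ d q 0 0 (cmod (h.2 ord0 ord_max))
   (1 + cmod q.[0] / cmod (h.2 ord0 ord_max)) (ltnW d2) szq bpos.
- by rewrite qd.
- by rewrite addr_ge0 // divr_ge0 ?cmod_ge0.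
- set b := cmod _ in bpos *; have D0 : 0 <= cmod q.[0] / b.
    by rewrite divr_ge0 ?cmod_ge0.
  rewrite subr0 [leRHS]mulrC -(ler_pdivrMr _ _ bpos).
  have h1 : 1 <= 1 + cmod q.[0] / b by rewrite lerDl.
  by apply: le_trans (ler_eXnr (ltnW d2) h1); rewrite lerDr.
have [|/eqP] := hom 1 w 0; last by rewrite oner_eq0.
rewrite top a0 mul0r; congr (_, _, _); rewrite -[RHS]qw horner_sum.
by apply: eq_bigr => i _; rewrite hornerZ hornerXn expr1n mulr1.
Qed.

End BoundedCoefficients.

(** * Skew products as fibered families *)

Section Frontier.
Context {R : realType}.

Lemma frontierP (A : set (Cx R)) w :
  (forall v, (forall r : R, 0 < r -> exists2 u, cmod (u - v) < r & A u) -> A v) ->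
  frontier A w <-> A w /\ forall r : R, 0 < r -> exists2 u, cmod (u - w) < r & ~ A u.
Proof.
move=> clA; split=> [[cw nw]|[aw far]].
  split=> [|r r0].
    apply: clA => r r0; have [|u [Au ur]] := cw [set u | cmod (u - w) < r].
      by apply/nbhs_cmodP; exists r.
    by exists u.
  apply: contrapT => nex; apply: nw; apply/nbhs_cmodP; exists r => // u ur.
  by apply: contrapT => nu; apply: nex; exists u.
split; first exact: subset_closure.
move=> /nbhs_cmodP[r r0 hr]; have [u ur nu] := far r r0.
exact/nu/hr.
Qed.

(** Above [rad] the sequence never decreases, so a large value at n forces a large one at n N. Hence
    a map and its [N]-th iterate have the same bounded orbits. *)
Lemma bounded_of_subsequence (a : nat -> R) (rad : R) N : 0 < rad -> (0 < N)%N ->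
  (forall k, rad <= a k -> 2 * a k <= a k.+1) ->
  (exists M, forall n, a (n * N)%N <= M) -> exists M, forall n, a n <= M.
Proof.
move=> rad0 N0 esc [M hM]; exists (Num.max rad M) => n.
rewrite leNgt gt_max; apply/negP => /andP[h1 h2].
have grow j : a n <= a (n + j)%N.
  elim: j => [|j IH]; first by rewrite addn0.
  have := esc (n + j)%N (le_trans (ltW h1) IH); rewrite -addnS; lra.
have := hM n; rewrite leNgt => /negP; apply.
apply: (lt_le_trans h2); rewrite -(subnKC (leq_pmulr n N0)); exact: grow.
Qed.

End Frontier.

Section BaseDynamics.
Context {R : realType} (d : nat) (m rad : R).
Implicit Types (p : {poly Cx R}) (z w : Cx R).

(** The modulus m e^d of [root_nearby], iterated over n successive pullbacks. *)
Definition lift_modulus n (e : R) : R := iter n (fun t => m * t ^+ d) e.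

Lemma lift_modulus_gt0 n e : 0 < m -> 0 < e -> 0 < lift_modulus n e.
Proof.
move=> m0 e0; elim: n => [//|n IH].
by rewrite /lift_modulus iterS mulr_gt0 // exprn_gt0.
Qed.

Lemma horner_poly_iter p n z : (poly_iter p n).[z] = iter n (horner p) z.
Proof.
elim: n => [|n IH]; first by rewrite hornerX.
by rewrite /poly_iter iterS horner_comp -/(poly_iter p n) IH.
Qed.

Lemma filled_juliaP p z :
  filled_julia p z <-> exists M : R, forall n, cmod (iter n (horner p) z) <= M.
Proof. by split=> -[M hM]; exists M => n; have := hM n; rewrite le_cmod. Qed.

Variables (p : {poly Cx R}) (N : nat).
Hypotheses (rad0 : 0 < rad) (N0 : (0 < N)%N).
Hypothesis escp : forall z, rad <= cmod z -> 2 * cmod z <= cmod p.[z].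

Let P := fun _ : unit => poly_iter p N.

Lemma forbit_base n z : forbit id P n tt z = iter (n * N) (horner p) z.
Proof.
elim: n => [|n IH]; first by rewrite forbit0.
by rewrite forbitSr IH horner_poly_iter -iterD.
Qed.

Lemma iter_escape n z : rad <= cmod z ->
  2 ^+ n * cmod z <= cmod (iter n (horner p) z).
Proof.
move=> hz; elim: n => [|n IH]; first by rewrite mul1r.
rewrite iterS exprS -mulrA.
have h : rad <= cmod (iter n (horner p) z).
  apply: (le_trans hz); apply: le_trans IH.
  by rewrite ler_peMl ?cmod_ge0 // exprn_ege1 // ler1n.
by apply: le_trans (escp h); rewrite ler_wpM2l.
Qed.

Lemma two_le_pow2 : 2 <= 2 ^+ N :> R.
Proof. by rewrite -natrX ler_nat -{1}[2%N]expn1 leq_pexp2l. Qed.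

Lemma base_escapes : escapes rad P.
Proof.
move=> [] z hz; rewrite horner_poly_iter; apply: le_trans (iter_escape N hz).
by rewrite ler_wpM2r ?cmod_ge0 // two_le_pow2.
Qed.

Lemma bounded_orbit_base z : bounded_orbit id P tt z <-> filled_julia p z.
Proof.
split=> [[M hM]|/filled_juliaP[M hM]]; last by exists M => n; rewrite forbit_base.
apply/filled_juliaP; apply: (bounded_of_subsequence rad0 N0).
  by move=> k /escp.
by exists M => n; rewrite -forbit_base.
Qed.

Lemma bdry_base z : bdry id P tt z <-> julia p z.
Proof.
have eqK : bounded_orbit id P tt = filled_julia p.
  by apply/funext => u; apply/propext; exact: bounded_orbit_base.
rewrite /bdry eqK /julia frontierP // => v; rewrite -eqK.
exact: bounded_closed base_escapes rad0.
Qed.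

Lemma filled_julia_iter z k : filled_julia p z -> filled_julia p (iter k (horner p) z).
Proof.
by move=> /filled_juliaP[M hM]; apply/filled_juliaP; exists M => n; rewrite -iterD.
Qed.

Lemma filled_julia_le z : filled_julia p z -> cmod z <= rad.
Proof. by move=> hz; apply: (bounded_le base_escapes rad0); apply/bounded_orbit_base. Qed.

Lemma julia_iter z : julia p z -> julia p (iter N (horner p) z).
Proof.
move=> hz; have := bdry_fwd ((bdry_base z).2 hz).
by rewrite horner_poly_iter => hz'; apply/bdry_base.
Qed.

Lemma julia_filled z : julia p z -> filled_julia p z.
Proof. by move=> hz; have [] := (bdry_base z).2 hz; move=> hb _; apply/bounded_orbit_base. Qed.

Hypotheses (d0 : (0 < d)%N) (szp : (size p <= d.+1)%N) (m0 : 0 < m).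
Hypothesis leadp : m <= cmod p`_d.

Lemma iter_liftable n e z y : 0 < e ->
  cmod (iter n (horner p) z - y) <= lift_modulus n e ->
  exists2 b, iter n (horner p) b = y & cmod (z - b) <= e.
Proof.
move=> e0; elim: n y => [|n IH] y hz; first by exists y.
have [|b by1 bz] := @root_nearby _ d p _ y m (lift_modulus n e) d0 szp m0 leadp _ hz.
  by rewrite ltW // lift_modulus_gt0.
by have [b' hb' bz'] := IH _ bz; exists b' => //; rewrite iterS hb'.
Qed.

Lemma base_liftable e : 0 < e -> liftable P e (lift_modulus N e).
Proof.
move=> e0 [] z y; rewrite horner_poly_iter => /(iter_liftable e0)[b hb bz].
by exists b; rewrite ?horner_poly_iter.
Qed.

Lemma poly_surj y : exists b, p.[b] = y.
Proof.
pose e := 1 + cmod (p.[0] - y) / m.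
have D0 : 0 <= cmod (p.[0] - y) / m by rewrite divr_ge0 ?cmod_ge0 ?ltW.
have e1 : 1 <= e by rewrite /e lerDl.
have [||b hb _] := @root_nearby _ d p 0 y m e d0 szp m0 leadp; last by exists b.
  by rewrite (le_trans ler01).
rewrite [leRHS]mulrC -(ler_pdivrMr _ _ m0).
by apply: le_trans (ler_eXnr d0 e1); rewrite /e lerDr.
Qed.

Lemma base_surj x y : exists b, (P x).[b] = y.
Proof.
rewrite /P; elim: N y => [|n IH] y; first by exists y; rewrite hornerX.
have [u hu] := poly_surj y; have [b hb] := IH u.
by exists b; rewrite horner_poly_iter iterS -horner_poly_iter hb.
Qed.

End BaseDynamics.

Section FiberDynamics.
Context {R : realType} (d : nat) (m rad radf : R) (h : coeffs R d).
Implicit Types (z w : Cx R).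
Local Notation p := (base_poly h).

Lemma iter_skew_map n z w :
  iter n (skew_map h) (z, w) = (iter n (horner p) z, (fiber_iter h n z).[w]).
Proof.
elim: n z w => [|n IH] z w; first by rewrite hornerX.
by rewrite iterSr [skew_map h (z, w)]/skew_map IH iterSr horner_comp.
Qed.

Lemma fiber_iterD n k z w : (fiber_iter h (n + k) z).[w]
  = (fiber_iter h n (iter k (horner p) z)).[(fiber_iter h k z).[w]].
Proof.
have := congr1 snd (iter_skew_map (n + k) z w).
by rewrite iterD !iter_skew_map.
Qed.

Lemma fiber_filledP z w : filled_julia p z ->
  fiber_filled_julia h z w <-> exists M : R, forall n, cmod (fiber_iter h n z).[w] <= M.
Proof.
move=> /filled_juliaP[M0 hM0]; split=> -[M hM].
  exists M => n; have := hM n; rewrite iter_skew_map prod_normE /=.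
  by rewrite num_ge_max => /andP[_]; rewrite le_cmod.
exists (Num.max M0 M) => n; rewrite iter_skew_map prod_normE /= num_ge_max.
by rewrite !le_cmod !le_max hM0 hM orbT.
Qed.

Variable N : nat.
Hypotheses (rad0 : 0 < rad) (radf0 : 0 < radf) (N0 : (0 < N)%N).
Hypothesis escp : forall z, rad <= cmod z -> 2 * cmod z <= cmod p.[z].
Hypothesis escq : forall z w, cmod z <= rad -> radf <= cmod w ->
  2 * cmod w <= cmod (fiber_poly h z).[w].

Lemma fiber_iter_step n z w :
  (fiber_iter h n.+1 z).[w] = (fiber_poly h (iter n (horner p) z)).[(fiber_iter h n z).[w]].
Proof. by rewrite -add1n fiber_iterD /= horner_comp hornerX. Qed.

Lemma fiber_step_escape n z w : filled_julia p z ->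
  radf <= cmod (fiber_iter h n z).[w] ->
  2 * cmod (fiber_iter h n z).[w] <= cmod (fiber_iter h n.+1 z).[w].
Proof.
move=> hz hw; rewrite fiber_iter_step; apply: escq => //.
exact/(filled_julia_le rad0 (ltn0Sn 0) escp)/filled_julia_iter.
Qed.

Lemma fiber_iter_escape n z w : filled_julia p z -> radf <= cmod w ->
  2 ^+ n * cmod w <= cmod (fiber_iter h n z).[w].
Proof.
move=> hz hw; elim: n => [|n IH]; first by rewrite mul1r hornerX.
rewrite exprS -mulrA; apply: le_trans (fiber_step_escape hz _).
  by rewrite ler_wpM2l.
apply: (le_trans hw); apply: le_trans IH.
by rewrite ler_peMl ?cmod_ge0 // exprn_ege1 // ler1n.
Qed.

Context {X : Type} (sg : X -> X) (theta : X -> Cx R).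
Hypothesis theta_sg : forall x, theta (sg x) = iter N (horner p) (theta x).
Hypothesis theta_filled : forall x, filled_julia p (theta x).

(** The index [x] is kept apart from the base point [theta x], so that two maps with different base
    polynomials become families over the same [sg]. *)
Let Q x := fiber_iter h N (theta x).

Lemma theta_iter n x : theta (iter n sg x) = iter (n * N) (horner p) (theta x).
Proof. by elim: n => [//|n IH]; rewrite iterS theta_sg IH -iterD. Qed.

Lemma forbit_fiber n x w : forbit sg Q n x w = (fiber_iter h (n * N) (theta x)).[w].
Proof.
elim: n => [|n IH]; first by rewrite forbit0 hornerX.
by rewrite forbitSr IH /Q theta_iter mulSn fiber_iterD.
Qed.

Lemma fiber_escapes : escapes radf Q.
Proof.
move=> x w hw; apply: le_trans (fiber_iter_escape N (theta_filled x) hw).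
by rewrite ler_wpM2r ?cmod_ge0 // two_le_pow2.
Qed.

Lemma bounded_orbit_fiber x w :
  bounded_orbit sg Q x w <-> fiber_filled_julia h (theta x) w.
Proof.
rewrite fiber_filledP //; split=> [[M hM]|[M hM]]; last first.
  by exists M => n; rewrite forbit_fiber.
apply: (bounded_of_subsequence radf0 N0).
  by move=> k; exact: fiber_step_escape.
by exists M => n; rewrite -forbit_fiber.
Qed.

Lemma bdry_fiber x w : bdry sg Q x w <-> fiber_julia h (theta x) w.
Proof.
have eqK : bounded_orbit sg Q x = fiber_filled_julia h (theta x).
  by apply/funext => u; apply/propext; exact: bounded_orbit_fiber.
rewrite /bdry eqK /fiber_julia frontierP // => v; rewrite -eqK.
exact: bounded_closed fiber_escapes radf0.
Qed.

Hypotheses (d0 : (0 < d)%N) (m0 : 0 < m).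
Hypothesis lead_fiber : forall z, m <= cmod (fiber_poly h z)`_d.

Lemma fiber_iter_liftable n e z w y : 0 < e ->
  cmod ((fiber_iter h n z).[w] - y) <= lift_modulus d m n e ->
  exists2 b, (fiber_iter h n z).[b] = y & cmod (w - b) <= e.
Proof.
elim: n e z w y => [|n IH] e z w y e0.
  by rewrite hornerX => hw; exists y; rewrite ?hornerX.
rewrite /lift_modulus iterSr horner_comp => hw.
have [|b1 by1 bw] := IH _ _ _ _ _ hw; first by rewrite mulr_gt0 ?exprn_gt0.
have [b hb bw'] :=
  root_nearby d0 (size_fiber_poly h z) m0 (lead_fiber z) (ltW e0) bw.
by exists b; rewrite // horner_comp hb.
Qed.

Lemma fiber_liftable e : 0 < e -> liftable Q e (lift_modulus d m N e).
Proof. by move=> e0 x w y; exact: fiber_iter_liftable. Qed.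

Lemma fiber_surj x y : exists b, (Q x).[b] = y.
Proof.
rewrite /Q; move: (theta x) => z; elim: N z y => [|n IH] z y.
  by exists y; rewrite hornerX.
have [u hu] := IH (base_poly h).[z] y.
have [b hb] := poly_surj d0 (size_fiber_poly h z) m0 (lead_fiber z) u.
by exists b; rewrite horner_comp hb.
Qed.

End FiberDynamics.

(** * Local constancy *)

Section Homeomorphic.

Lemma homeomorphic_sym (T U : topologicalType) (A : set T) (B : set U) :
  homeomorphic A B -> homeomorphic B A.
Proof. by move=> [f [g [h1 h2 h3 h4 [h5 h6]]]]; exists g, f; split. Qed.

Lemma within_continuous_comp (T U V : topologicalType) (A : set T) (B : set U)
    (f : T -> U) (g : U -> V) : f @` A `<=` B ->
  {within A, continuous f} -> {within B, continuous g} ->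
  {within A, continuous (g \o f)}.
Proof.
move=> fAB /subspace_continuousP cf /subspace_continuousP cg.
apply/subspace_continuousP => x Ax W hW.
have Bfx : B (f x) by apply: fAB; exists x.
have h : nbhs x [set t | A t -> B (f t) -> W (g (f t))] := cf x Ax _ (cg _ Bfx W hW).
suff : nbhs x [set t | A t -> W (g (f t))] by [].
apply: filterS h => t ht At.
by apply: ht => //; apply: fAB; exists t.
Qed.

Lemma homeomorphic_trans (T U V : topologicalType) (A : set T) (B : set U) (C : set V) :
  homeomorphic A B -> homeomorphic B C -> homeomorphic A C.
Proof.
move=> [f [g [fA gB gf fg [cf cg]]]] [f' [g' [fB gC gf' fg' [cf' cg']]]].
exists (f' \o f), (g \o g'); split.
- by move=> _ [x Ax <-]; apply: fB; exists (f x) => //; apply: fA; exists x.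
- by move=> _ [x Cx <-]; apply: gB; exists (g' x) => //; apply: gC; exists x.
- by move=> x Ax /=; have Bx : B (f x) by [apply: fA; exists x]; rewrite gf' // gf.
- by move=> x Cx /=; have Bx : B (g' x) by [apply: gC; exists x]; rewrite fg // fg'.
- by split; [exact: within_continuous_comp fA cf cf'|exact: within_continuous_comp gC cg' cg].
Qed.

Context {R : realType}.

Lemma within_continuous_cmod (A : set (Cx R)) (f : Cx R -> Cx R) :
  (forall x, A x -> forall e : R, 0 < e -> exists2 del, 0 < del &
     forall y, A y -> cmod (y - x) < del -> cmod (f y - f x) < e) ->
  {within A, continuous f}.
Proof.
move=> hf; apply/subspace_continuousP => x Ax W /nbhs_cmodP[e e0 hW].
have [del del0 hd] := hf x Ax e e0; apply/nbhs_cmodP; exists del => // y yx Ay.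
exact/hW/hd.
Qed.

(** Bernoulli's inequality; 4 is the derivative bound that [fiber_stability] requires. *)
Lemma pow_large (c L : R) : 0 < c -> 1 < L ->
  exists N, forall n, (N <= n)%N -> 4 <= c * L ^+ n.
Proof.
move=> c0 L1; have L10 : 0 < c * (L - 1) by rewrite mulr_gt0 // subr_gt0.
have bern n : 1 + n%:R * (L - 1) <= L ^+ n.
  elim: n => [|n IH]; first by rewrite mul0r addr0.
  rewrite exprS -natr1; have n0 : 0 <= n%:R :> R by [].
  apply: (@le_trans _ _ (L * (1 + n%:R * (L - 1)))); last by rewrite ler_wpM2l //; lra.
  by have := mulr_ge0 n0 (sqr_ge0 (L - 1)); rewrite expr2; lra.
exists (Num.bound (4 / (c * (L - 1)))) => n Nn.
have h : 4 / (c * (L - 1)) <= n%:R.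
  apply: (@le_trans _ _ (Num.bound (4 / (c * (L - 1))))%:R).
    by rewrite ltW // archi_boundP // divr_ge0 // ltW.
  by rewrite ler_nat.
rewrite ler_pdivrMr // in h.
by have := ler_wpM2l (ltW c0) (bern n); lra.
Qed.

End Homeomorphic.

(** * Conjugacy of nearby skew products *)

Section LocalConjugacy.
Context {R : realType} (d : nat).
Hypothesis d2 : (2 <= d)%N.
Implicit Types (g h : coeffs R d) (z w : Cx R).

Lemma near_bounded_coeffs g : is_skew_product g -> exists m M : R,
  [/\ 0 < m, 0 <= M & exists2 del, 0 < del & forall h, is_skew_product h ->
      near_coeffs del g h -> bounded_coeffs m M h].
Proof.
move=> /(skew_product_lead d2)[]; rewrite -!cmod_gt0.
set a := cmod _; set b := cmod _ => a0 b0.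
pose m := Num.min (a / 2) (b / 2).
have [ma mb] : m <= a / 2 /\ m <= b / 2 by split; rewrite ge_min lexx ?orbT.
have m0 : 0 < m by rewrite lt_min !divr_gt0.
pose M1 := \sum_(i < d.+1) cmod (g.1 ord0 i).
pose M2 := \sum_(i < d.+1) \sum_(j < d.+1) cmod (g.2 i j).
have M10 : 0 <= M1 by apply: sumr_ge0 => *; exact: cmod_ge0.
have M20 : 0 <= M2 by apply: sumr_ge0 => i _; apply: sumr_ge0 => *; exact: cmod_ge0.
have g1 i : cmod (g.1 ord0 i) <= M1.
  by rewrite /M1 (bigD1 i) //= lerDl; apply: sumr_ge0 => *; exact: cmod_ge0.
have g2 i j : cmod (g.2 i j) <= M2.
  rewrite /M2 (bigD1 i) //= (bigD1 j) //= -addrA lerDl.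
  by apply: addr_ge0; apply: sumr_ge0 => *; rewrite ?sumr_ge0 // => *; exact: cmod_ge0.
exists m, (M1 + M2 + 1); split=> //; first by rewrite !addr_ge0.
exists (Num.min m 1); first by rewrite lt_min m0 ltr01.
move=> h [hdeg _] [n1 n2].
have k1 i : cmod (g.1 ord0 i - h.1 ord0 i) <= m /\ cmod (g.1 ord0 i - h.1 ord0 i) <= 1.
  by have := n1 i; rewrite le_min => /andP.
have k2 i j : cmod (g.2 i j - h.2 i j) <= m /\ cmod (g.2 i j - h.2 i j) <= 1.
  by have := n2 i j; rewrite le_min => /andP.
split=> //.
- have [h1 _] := k1 ord_max.
  by have := cmodB_ge (g.1 ord0 ord_max) (g.1 ord0 ord_max - h.1 ord0 ord_max);
    rewrite subKr -/a; lra.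
- have [h1 _] := k2 ord0 ord_max.
  by have := cmodB_ge (g.2 ord0 ord_max) (g.2 ord0 ord_max - h.2 ord0 ord_max);
    rewrite subKr -/b; lra.
- move=> i; have [_ h1] := k1 i; have := g1 i; have := cmodB_ge (h.1 ord0 i) (g.1 ord0 i).
  by rewrite [cmod (h.1 _ _ - _)]cmodC; lra.
- move=> i j; have [_ h1] := k2 i j; have := g2 i j; have := cmodB_ge (h.2 i j) (g.2 i j).
  by rewrite [cmod (h.2 _ _ - _)]cmodC; lra.
Qed.

Lemma near_coeffs_refl (del : R) g : 0 <= del -> near_coeffs del g g.
Proof. by move=> del0; split=> *; rewrite subrr cmod0. Qed.

(** Constants are chosen from the fibers down to the base: [tauF] is the closeness needed in the
    fibers, [delF] the change of coefficients and base point that ensures it, and the base conjugacy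
    must then move points by at most [delF]. *)
Theorem local_conjugacy g : is_skew_product g -> axiomA g ->
  exists2 del : R, 0 < del & forall h, is_skew_product h -> near_coeffs del g h ->
  exists phi : Cx R -> Cx R,
   (forall z, julia (base_poly g) z -> julia (base_poly h) (phi z) /\
      homeomorphic (fiber_julia g z) (fiber_julia h (phi z))) /\
   (forall z', julia (base_poly h) z' -> exists2 z, julia (base_poly g) z & phi z = z').
Proof.
move=> skg [[c1 [L1 [c10 L11 exp1]]] [c2 [L2 [c20 L21 exp2]]] _].
have [N1 hN1] := pow_large c10 L11; have [N2 hN2] := pow_large c20 L21.
(* A common iterate expands by a factor at least 4 both on the base and in the fibers. *)
have [N [N0 {}hN1 {}hN2]] :
    exists N, [/\ (0 < N)%N, 4 <= c1 * L1 ^+ N & 4 <= c2 * L2 ^+ N].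
  exists (N1 + N2).+1; split=> //; first by apply: hN1; rewrite leqW // leq_addr.
  by apply: hN2; rewrite leqW // leq_addl.
have [m [M [m0 M0 [dela dela0 hcoef]]]] := near_bounded_coeffs skg.
have gcoef : bounded_coeffs m M g by apply: hcoef => //; apply: near_coeffs_refl; exact: ltW.
have d0 : (0 < d)%N by apply: ltnW.
pose rad := escape_radius d m M.
have rad1 : 1 < rad by exact: escape_radius_gt1.
have rad0 : 0 < rad by lra.
pose Mf := d.+1%:R * (M * rad ^+ d).
have Mf0 : 0 <= Mf by rewrite !mulr_ge0 // exprn_ge0 // ltW.
pose radf := escape_radius d m Mf.
have radf1 : 1 < radf by exact: escape_radius_gt1.
have radf0 : 0 < radf by lra.
have escp h : bounded_coeffs m M h ->
    forall z, rad <= cmod z -> 2 * cmod z <= cmod (base_poly h).[z].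
  by move=> hh z; apply: (admissible_escape d2 m0 M0); exact: base_admissible.
have escq h : bounded_coeffs m M h -> forall z w, cmod z <= rad -> radf <= cmod w ->
    2 * cmod w <= cmod (fiber_poly h z).[w].
  move=> hh z w hz; apply: (admissible_escape d2 m0 Mf0).
  exact: fiber_admissible M0 (ltW rad1) hz hh.
have leadp h : bounded_coeffs m M h -> m <= cmod (base_poly h)`_d.
  by move=> /(base_admissible M0)[].
have leadq h : bounded_coeffs m M h -> forall z, m <= cmod (fiber_poly h z)`_d.
  by move=> [_ h1 _ _ h3] z; rewrite lead_fiber_poly.
have szp h : (size (base_poly h) <= d.+1)%N by rewrite size_poly.
pose P h := fun _ : unit => poly_iter (base_poly h) N.
pose X := {z : Cx R | julia (base_poly g) z}.
pose sg (x : X) : X :=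
  exist _ _ (julia_iter rad0 N0 (escp g gcoef) (svalP x)).
pose Q h (theta : X -> Cx R) := fun x => fiber_iter h N (theta x).
have sval_sg (x : X) : sval (sg x) = iter N (horner (base_poly g)) (sval x) by [].
have filled_g (x : X) : filled_julia (base_poly g) (sval x).
  exact: (julia_filled rad0 N0 (escp g gcoef)) (svalP x).
have [bndB contB] := @luc_base_iter R d g N.
have [bndF contF] := @luc_fiber_iter R d g N.
pose rho := rad + radf + 1.
have [AF AF0 hAF] := bndF rho.
have [||tauF tauF0 stabF] := @fiber_stability R X sg (Q g sval) radf AF 1
    (lift_modulus d m N) (ltW radf1)
    (fiber_escapes rad0 N0 (escp g gcoef) (escq g gcoef) filled_g)
    (fiber_surj N sval d0 m0 (leadq g gcoef))
    (fun e => @lift_modulus_gt0 R d m N e m0)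
    (fun e => fiber_liftable d0 m0 (leadq g gcoef) (e := e)) AF0 _ _ ltr01.
- move=> x w hw; apply: hAF; last by rewrite /rho; lra.
  have := filled_julia_le rad0 N0 (escp g gcoef) (filled_g x); rewrite /rho; lra.
- move=> x w.
  move=> /(bdry_fiber rad0 radf0 N0 (escp g gcoef) (escq g gcoef) sval_sg filled_g) hw.
  apply: (le_trans hN2); have := exp2 (sval x) w N (svalP x) hw N0.
  by rewrite ge_cmod.
have [delF delF0 closeF] := contF rho tauF tauF0.
have [AB AB0 hAB] := bndB rho.
have [||tauB tauB0 stabB] := @fiber_stability R unit id (P g) rad AB delF
    (lift_modulus d m N) (ltW rad1) (base_escapes N0 (escp g gcoef))
    (base_surj N d0 (szp g) m0 (leadp g gcoef))
    (fun e => @lift_modulus_gt0 R d m N e m0)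
    (fun e => base_liftable (N := N) d0 (szp g) m0 (leadp g gcoef) (e := e)) AB0 _ _ delF0.
- move=> [] z hz; rewrite horner_poly_iter; apply: (hAB z 0).
    by rewrite /rho; lra.
  by rewrite cmod0 /rho; lra.
- move=> [] z /(bdry_base rad0 N0 (escp g gcoef)) hz.
  by apply: (le_trans hN1); have := exp1 z N hz N0; rewrite ge_cmod.
have [delB delB0 closeB] := contB rho tauB tauB0.
pose del := Num.min dela (Num.min delF delB).
have [la lF lB] : [/\ del <= dela, del <= delF & del <= delB].
  by split; rewrite /del !ge_min lexx ?orbT.
exists del; first by rewrite !lt_min dela0 delF0.
move=> h skh gh.
have hh : bounded_coeffs m M h by apply: hcoef => //; exact: near_coeffsW gh.
have [|phiB [psiB [b1 b2 _ _]]] := stabB (P h) (base_escapes N0 (escp h hh))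
  (fun e => base_liftable (N := N) d0 (szp h) m0 (leadp h hh) (e := e)).
  move=> [] z hz; rewrite !horner_poly_iter.
  apply: (closeB h z z 0 0) => //; rewrite ?subrr ?cmod0 ?(ltW delB0) //.
  - exact: near_coeffsW gh.
  - by rewrite /rho; lra.
  - by rewrite /rho; lra.
pose phi := phiB tt.
have phiP z : julia (base_poly g) z -> [/\ julia (base_poly h) (phi z),
    cmod (phi z - z) <= delF &
    phi (iter N (horner (base_poly g)) z) = iter N (horner (base_poly h)) (phi z)].
  move=> /(bdry_base rad0 N0 (escp g gcoef))/b1[c _ c' c''].
  split; [exact/(bdry_base rad0 N0 (escp h hh))|by []|].
  by move: c''; rewrite !horner_poly_iter.
exists phi; split; last first.
  move=> z' /(bdry_base rad0 N0 (escp h hh))/b2[c c'].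
  by exists (psiB tt z') => //; apply/(bdry_base rad0 N0 (escp g gcoef)).
(* The fiber of [h] over phi(z) is compared with that of [g] over z; the equivariance of [phi] turns
   the former into a family over [sg]. *)
pose theta (x : X) := phi (sval x).
have theta_sg x : theta (sg x) = iter N (horner (base_poly h)) (theta x).
  by have [_ _] := phiP _ (svalP x).
have filled_h (x : X) : filled_julia (base_poly h) (theta x).
  have [hx _ _] := phiP _ (svalP x).
  exact: (julia_filled rad0 N0 (escp h hh)) hx.
have [|phiF [psiF [f1 f2 f3 f4]]] := stabF (Q h theta)
  (fiber_escapes rad0 N0 (escp h hh) (escq h hh) filled_h)
  (fun e => fiber_liftable d0 m0 (leadq h hh) (e := e)).
  move=> x w hw; apply: closeF; rewrite ?subrr ?cmod0 ?(ltW delF0) //.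
  - exact: near_coeffsW gh.
  - have := filled_julia_le rad0 N0 (escp g gcoef) (filled_g x); rewrite /rho; lra.
  - by rewrite /rho; lra.
  - by rewrite cmodC; have [] := phiP _ (svalP x).
move=> z hz; split; first by have [] := phiP z hz.
pose x : X := exist _ z hz.
have Jg w : bdry sg (Q g sval) x w <-> fiber_julia g z w.
  exact: (bdry_fiber rad0 radf0 N0 (escp g gcoef) (escq g gcoef) sval_sg filled_g).
have Jh w : bdry sg (Q h theta) x w <-> fiber_julia h (phi z) w.
  exact: (bdry_fiber rad0 radf0 N0 (escp h hh) (escq h hh) theta_sg filled_h).
exists (phiF x), (psiF x); split.
- by move=> _ [w /Jg/f1[hw _ _ _] <-]; apply/Jh.
- by move=> _ [w /Jh/f2[hw _] <-]; apply/Jg.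
- by move=> w /Jg/f1[].
- by move=> w /Jh/f2[].
split; apply: within_continuous_cmod => w.
  move=> /Jg/f3 hw e /hw[del' del'0 hd]; exists del' => // v /Jg; exact: hd.
move=> /Jh/f4 hw e /hw[del' del'0 hd]; exists del' => // v /Jh; exact: hd.
Qed.

Lemma nbhs_near_coeffs (del : R) g : 0 < del -> nbhs g [set h | near_coeffs del g h].
Proof.
move=> del0; apply/nbhs_ballP; exists del%:C%C; first by rewrite /= ltcR.
move=> h [[_ h1] [_ h2]]; split=> [i|i j].
  by apply/ltW/ball_cmod.
by apply/ltW/ball_cmod.
Qed.

End LocalConjugacy.

(** * Products, and propagation along a hyperbolic component *)

Section Product.
Context {R : realType} (d : nat).
Hypothesis d2 : (2 <= d)%N.

Lemma homeomorphic_refl (T : topologicalType) (A : set T) : homeomorphic A A.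
Proof.
exists id, id; split=> //; try by move=> _ [x Ax <-].
by split; apply/continuous_subspaceT => x.
Qed.

Lemma julia_filled_base (h : coeffs R d) z : is_skew_product h ->
  julia (base_poly h) z -> filled_julia (base_poly h) z.
Proof.
move=> skh; have [m [M [m0 M0 [del del0 hcoef]]]] := near_bounded_coeffs d2 skh.
have hh : bounded_coeffs m M h by apply: hcoef => //; apply: near_coeffs_refl; exact: ltW.
apply: (@julia_filled R (escape_radius d m M) _ 1) => //.
  exact: lt_trans ltr01 (escape_radius_gt1 d m0 M0).
by move=> u; apply: (admissible_escape d2 m0 M0); exact: base_admissible.
Qed.

(** Over a bounded base orbit only the second coordinate decides boundedness, and it is iterated by
    [q0]. *)
Lemma fiber_julia_product (f0 : coeffs R d) (p0 q0 : {poly Cx R}) z :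
  is_skew_product f0 -> (forall z w, skew_map f0 (z, w) = (p0.[z], q0.[w])) ->
  julia (base_poly f0) z -> fiber_julia f0 z = julia q0.
Proof.
move=> sk0 prod0 /(julia_filled_base sk0) hz.
suff eqK : fiber_filled_julia f0 z = filled_julia q0 by rewrite /fiber_julia eqK.
have iterE n w : (fiber_iter f0 n z).[w] = iter n (horner q0) w.
  have <- : (iter n (skew_map f0) (z, w)).2 = iter n (horner q0) w.
    elim: n => [//|n IH]; rewrite !iterS -IH.
    by case: (iter n _ _) => a b; rewrite prod0.
  by rewrite iter_skew_map.
apply/funext => w; apply/propext; rewrite fiber_filledP // filled_juliaP.
by split=> -[M hM]; exists M => n; [rewrite -iterE|rewrite iterE].
Qed.

(** The part of [H] in [P] is nonempty and relatively open and closed. Points are compared within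
    [H] only, as a neighbourhood may leave it. *)
Lemma connected_locally_constant (T : topologicalType) (H P : set T) a b :
  connected H -> (forall g, H g -> \forall h \near g, H h -> (P g <-> P h)) ->
  H a -> H b -> P a -> P b.
Proof.
move=> cH loc Ha Hb Pa.
suff eqH : H `&` P = H by have : (H `&` P) b by [rewrite eqH]; case.
apply: cH; first by exists a.
- exists [set h | H h -> P h]°; first exact: open_interior.
  apply/seteqP; split=> [g [Hg Pg]|g [Hg /interior_subset]]; last by split=> //; auto.
  by split=> //; have := loc g Hg; apply: filterS => h hh /hh[]; auto.
- exists (~` [set h | H h -> ~ P h]°); first exact/open_closedC/open_interior.
  apply/seteqP; split=> [g [Hg Pg]|g [Hg ng]].
    by split=> // /interior_subset; apply.
  split=> //; apply: contrapT => nPg; apply: ng.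
  by have := loc g Hg; apply: filterS => h hh /hh[_ hp] /hp.
Qed.

End Product.

Theorem corollary4p4 (R : realType) (d : nat) (hd : (2 <= d)%N)
    (f f0 : coeffs R d) (p0 q0 : {poly Cx R})
    (hf : is_skew_product f) (hfA : axiomA f)
    (hf0 : forall z w : Cx R, skew_map f0 (z, w) = (p0.[z], q0.[w]))
    (hH : exists H : set (coeffs R d),
        [/\ hyperbolic_component H, H f & H f0]) :
  forall z : Cx R, julia (base_poly f) z ->
    homeomorphic (fiber_julia f z) (julia q0).
Proof.
move: hH => [H [[f1 hf1 HE] Hf Hf0]].
have Hlocus h : H h -> is_skew_product h /\ axiomA h.
  by rewrite HE => /connected_component_sub.
have cH : connected H by rewrite HE; exact: component_connected.
pose P := [set h : coeffs R d | forall z, julia (base_poly h) z ->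
  homeomorphic (fiber_julia h z) (julia q0)].
apply: (@connected_locally_constant _ H P f0 f) => // [g Hg|z hz]; last first.
  rewrite (fiber_julia_product hd (Hlocus _ Hf0).1 hf0 hz).
  exact: homeomorphic_refl.
have [skg axg] := Hlocus g Hg.
have [del del0 conj] := local_conjugacy hd skg axg.
have := nbhs_near_coeffs g del0; apply: filterS => h gh Hh.
have [phi [phiJ phi_onto]] := conj h (Hlocus h Hh).1 gh.
(* Surjectivity of [phi] carries goodness from [g] to [h]; that [phi] maps Julia set into Julia set
   carries it back. *)
split=> [Pg z' /phi_onto[z hz <-]|Ph z hz].
  apply: homeomorphic_trans (homeomorphic_sym (phiJ z hz).2) (Pg z hz).
exact: homeomorphic_trans (phiJ z hz).2 (Ph _ (phiJ z hz).1).
Qed.
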